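(* Let $T$ be the (real) Tsirelson space and $T^*$ its dual Banach space. Then $\lim_{n\to\infty} \Theta_{T^*}(n) \geq 1/2$.
   Context: For a Banach space $X$, $B_X$ is its closed unit ball. For $A \subset X$, the essential inradius $\varrho(A) \in [0,\infty]$ is $$\varrho(A) = \sup\{ r>0 : \exists x \in A,\ \exists Y \subset X \text{ closed subspace with } \dim(X/Y)<\infty,\ x + r B_Y \subset A\},$$ where $B_Y = B_X \cap Y$ (and $\sup \emptyset = 0$). Let $\mathcal{C}(X)$ be the family of bounded closed convex subsets of $X$. The covering index is $$\Theta_X(n) = \inf\Big\{ \max_{1\le k\le n} \varrho(A_k) : (A_k)_{k=1}^n \subset \mathcal{C}(X),\ \bigcup_{k=1}^n A_k = B_X \Big\}, \qquad n \in \mathbb{N}.$$ The sequence $(\Theta_X(n))_n$ is non-increasing, so its limit exists. Convention on $T$: $T$ is the space that ''looks like $\ell_1$'', while $T^*$ ''takes after $c_0$''. Explicitly, $T$ is the completion of the space $c_{00}$ of finitely supported real sequences under the unique norm satisfying $$\|x\| = \max\Big\{ \|x\|_\infty,\ \tfrac12 \sup \sum_{i=1}^k \|E_i x\| \Big\},$$ where the supremum is over all $k \in \mathbb{N}$ and all finite nonempty sets $E_1 < E_2 < \dots < E_k$ of positive integers (meaning $\max E_i < \min E_{i+1}$) with $k \le \min E_1$, and $E_i x$ is the restriction of $x$ to the coordinates in $E_i$ (zero elsewhere). *)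

(* Defs.v *)
From HB Require Import structures.
From mathcomp Require Import all_boot all_order all_algebra.
From mathcomp Require Import generic_quotient ring_quotient finmap.
From mathcomp Require Import all_classical all_reals all_analysis.
From mathcomp Require Import lra.

Set Implicit Arguments.
Unset Strict Implicit.
Unset Printing Implicit Defensive.

Import Order.TTheory GRing.Theory Num.Theory.
Import numFieldNormedType.Exports.

Local Open Scope classical_set_scope.
Local Open Scope ring_scope.

Definition unit_ball (R : realType) (X : normedModType R) : set X :=
  [set x | `|x| <= 1].

Section CoveringIndex.
Variables (R : realType) (X : completeNormedModType R).

(* dim (X / Y) < oo, for Y a subspace: finitely many classes span X / Y. *)
Definition finite_codim (Y : set X) : Prop :=
  exists (d : nat) (e : 'I_d -> X),
    forall x, exists a : 'I_d -> R, Y (x - \sum_(i < d) a i *: e i).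

Definition closed_finite_codim (Y : set X) : Prop :=
  [/\ submod_closed (fun x => x \in Y), closed Y & finite_codim Y].

(* The maximum with 0 only matters when the set of radii is empty, since
   ereal_sup set0 = -oo whereas here we want sup set0 = 0. *)
Definition ess_inradius (A : set X) : \bar R :=
  maxe 0%E (ereal_sup [set r%:E | r in [set r : R | 0 < r /\
    exists2 x, A x & exists2 Y, closed_finite_codim Y &
      [set x + r *: y | y in @unit_ball R X `&` Y] `<=` A]]).

Definition bounded_closed_convex (A : set X) : Prop :=
  [/\ bounded_set A, closed A & convex_set A].

(* The index is meant for n >= 1: covering_index 0 = +oo, there being no empty
   cover.  As 0 <= ess_inradius, starting the maximum at 0 is harmless. *)
Definition covering_index (n : nat) : \bar R :=
  ereal_inf [set \big[maxe/0%E]_(k < n) ess_inradius (A k) |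
    A in [set A : 'I_n -> set X | (forall k, bounded_closed_convex (A k)) /\
                                  \bigcup_k A k = @unit_ball R X]].

Lemma ess_inradius_ge0 A : (0 <= ess_inradius A)%E.
Proof. by rewrite le_max lexx. Qed.

Lemma ess_inradius_set0 : ess_inradius set0 = 0%E.
Proof.
rewrite /ess_inradius (_ : [set r%:E | r in _] = set0).
  by rewrite ereal_sup0 maxEge leNye.
by rewrite -subset0 => _ [r [_ [x []]]].
Qed.

Lemma covering_index_nonincreasing : nonincreasing_seq covering_index.
Proof.
move=> n m nm; apply: le_ereal_inf_tmp => _ [A [Abcc AB] <-].
pose A' (k : 'I_m) : set X :=
  if insub (k : nat) is Some i then A (i : 'I_n) else set0.
have A'E (i : 'I_n) : A' (widen_ord nm i) = A i.
  by rewrite /A' /= valK.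
have A'0 (k : 'I_m) : A' k = set0 \/ exists2 i, k = widen_ord nm i & A' k = A i.
  rewrite /A'; case: insubP => [i _ ik|]; last by left.
  by right; exists i => //; apply: val_inj; rewrite /= ik.
apply: ge_ereal_inf; exists (\big[maxe/0%E]_(k < m) ess_inradius (A' k)).
  exists A' => //; split=> [k|]; last first.
    rewrite -AB; apply/seteqP; split=> x [k _].
      by have [->|[i _ ->]] := A'0 k; [case|exists i].
    by move=> Akx; exists (widen_ord nm k) => //; rewrite A'E.
  have [->|[i _ ->]] := A'0 k; last exact: Abcc.
  split; [by exists 0; split=> [|M _ x []]; first exact: num_real|exact: closed0|].
  by move=> x y l; rewrite inE.
elim/big_ind : _ => [|x y x0 y0|k _].
- elim/big_ind : _ => // [x y x0 y0|i _]; last exact: ess_inradius_ge0.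
  by rewrite le_max x0.
- by rewrite ge_max x0 y0.
- have [->|[i _ ->]] := A'0 k; last exact: le_bigmax_cond.
  rewrite ess_inradius_set0.
  elim/big_ind : _ => // [x y x0 y0|i _]; last exact: ess_inradius_ge0.
  by rewrite le_max x0.
Qed.

Lemma covering_index_is_cvg : cvgn covering_index.
Proof.
by apply: ereal_nonincreasing_is_cvgn; exact: covering_index_nonincreasing.
Qed.

End CoveringIndex.

Section Dual.
Variables (R : realType) (X : normedModType R).

Definition is_dual : {pred X -> R^o} :=
  fun f => `[< linear f /\ continuous f >].

Lemma dual_submod_closed : submod_closed is_dual.
Proof.
split.
  apply/asboolP; split; last exact: cst_continuous.
  by move=> a x y; rewrite scaler0 addr0.
move=> a f g /asboolP[lf cf] /asboolP[lg cg]; apply/asboolP; split.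
  move=> b x y; rewrite /= !fctE lf lg !scalerDr !scalerA [b * a]mulrC.
  by rewrite -!addrA; congr +%R; rewrite addrCA.
by move=> x; apply: cvgD; [apply: cvgZl_tmp; exact: cf|exact: cg].
Qed.

HB.instance Definition _ :=
  GRing.isSubmodClosed.Build R (X -> R^o) is_dual dual_submod_closed.

Record dual : Type := Dual { dual_fun :> X -> R^o; dualP : is_dual dual_fun }.

HB.instance Definition _ := [isSub for dual_fun].
HB.instance Definition _ := [Choice of dual by <:].
HB.instance Definition _ := [SubChoice_isSubLmodule of dual by <:].

Definition dual_norm (f : dual) : R :=
  sup [set `|f x| | x in @unit_ball R X].

Lemma dual_linear (f : dual) : linear f.
Proof. by have /asboolP[] := dualP f. Qed.

Lemma dual_continuous (f : dual) : continuous f.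
Proof. by have /asboolP[] := dualP f. Qed.

HB.instance Definition _ (f : dual) :=
  GRing.isLinear.Build R X R^o *:%R (dual_fun f) (dual_linear f).

Lemma dual_norm_has_sup (f : dual) : has_sup [set `|f x| | x in @unit_ball R X].
Proof.
split; first by exists `|f 0|, 0 => //; rewrite /unit_ball /= normr0 ler01.
have /linear_bounded_continuous/linear_boundedP := @dual_continuous f.
move=> /pinfty_ex_gt0[M M0 fM]; exists M => _ [x x1 <-].
by rewrite (le_trans (fM x))// -[leRHS]mulr1 ler_wpM2l// ltW.
Qed.

Lemma dual_norm_ub (f : dual) x : `|f x| <= dual_norm f * `|x|.
Proof.
have [->|x0] := eqVneq x 0; first by rewrite linear0 !normr0 mulr0.
have nx : 0 < `|x| by rewrite normr_gt0.
rewrite -ler_pdivrMr//.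
have -> : `|f x| / `|x| = `|f (`|x|^-1 *: x)|.
  by rewrite linearZ/= normrM mulrC ger0_norm// invr_ge0 ltW.
apply: (sup_upper_bound (dual_norm_has_sup f)); exists (`|x|^-1 *: x) => //.
by rewrite /unit_ball/= normrZ ger0_norm ?invr_ge0// mulVf// gt_eqF.
Qed.

Lemma dual_norm_le (f : dual) M : 0 <= M ->
  (forall x, `|f x| <= M * `|x|) -> dual_norm f <= M.
Proof.
move=> M0 fM; apply: ge_sup; first by have [] := dual_norm_has_sup f.
move=> _ [x x1 <-]; apply: (le_trans (fM x)).
by rewrite -[leRHS]mulr1 ler_wpM2l.
Qed.

Lemma dual_norm_ge0 (f : dual) : 0 <= dual_norm f.
Proof.
apply: le_trans (sup_upper_bound (dual_norm_has_sup f) _); last first.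
  by exists 0 => //; rewrite /unit_ball /= normr0 ler01.
exact: normr_ge0.
Qed.

Lemma dual_norm_triangle (f g : dual) :
  dual_norm (f + g) <= dual_norm f + dual_norm g.
Proof.
apply: dual_norm_le => [|x]; first by rewrite addr_ge0 ?dual_norm_ge0.
by rewrite (le_trans (ler_normD _ _))// mulrDl lerD ?dual_norm_ub.
Qed.

Lemma dual_normZ (a : R) (f : dual) : dual_norm (a *: f) = `|a| * dual_norm f.
Proof.
have le b g : dual_norm (b *: g) <= `|b| * dual_norm g.
  apply: dual_norm_le => [|x]; first by rewrite mulr_ge0 ?dual_norm_ge0.
  by rewrite /= normrM -mulrA ler_wpM2l ?dual_norm_ub.
apply/eqP; rewrite eq_le le/=.
have [->|a0] := eqVneq a 0; first by rewrite normr0 mul0r dual_norm_ge0.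
rewrite -{1}[f](scalerK a0) -ler_pdivlMl ?normr_gt0//.
by rewrite -normfV le.
Qed.

Lemma dual_norm0_eq0 (f : dual) : dual_norm f = 0 -> f = 0.
Proof.
move=> f0; apply/val_inj/funext => x /=; apply/eqP.
by rewrite -normr_le0 (le_trans (dual_norm_ub f x))// f0 mul0r.
Qed.

HB.instance Definition _ := Lmodule_isNormed.Build R dual
  dual_norm_triangle dual_normZ dual_norm0_eq0.

Lemma dual_normE (f : dual) : `|f| = dual_norm f.
Proof. by []. Qed.

End Dual.

Definition cauchy_seq (R : realType) (V : normedModType R) (u : nat -> V) :=
  forall e : R, 0 < e ->
    exists N, forall m n, (N <= m)%N -> (N <= n)%N -> `|u m - u n| <= e.

Lemma cauchy_seq_complete (R : realType) (V : normedModType R) :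
  (forall u : nat -> V, cauchy_seq u -> cvgn u) ->
  forall F : set_system V, ProperFilter F -> cauchy F -> cvg F.
Proof.
move=> cV F PF cF.
have H n : exists x, F (ball x (n.+1%:R^-1 : R)).
  by move/cauchyP : cF; apply; rewrite invr_gt0.
have {H} [u Fu] := choice H.
have small (e : R) : 0 < e -> exists N, forall n, (N <= n)%N -> n.+1%:R^-1 <= e.
  move=> e0; exists (Num.truncn e^-1) => n Nn.
  rewrite invf_ple ?posrE// ltW//.
  rewrite (lt_le_trans (truncnS_gt _))// ler_nat.
  by rewrite ltnS.
have cu : cauchy_seq u.
  move=> e e0; have [N HN] := small _ (divr_gt0 e0 (ltr0Sn _ 1)).
  exists N => m n Nm Nn.
  have [z [zm zn]] := filter_ex (filterI (Fu m) (Fu n)).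
  move: zm zn; rewrite -!ball_normE /= => zm zn.
  rewrite (splitr e) -(subrKA z) (le_trans (ler_normD _ _))//.
  rewrite lerD// ltW//; first by rewrite (lt_le_trans zm)// HN.
  by rewrite distrC (lt_le_trans zn)// HN.
have /cvg_ex[l ul] := cV u cu; apply/cvg_ex; exists l.
apply/cvgrPdist_le => e e0.
have [N HN] := small _ (divr_gt0 e0 (ltr0Sn _ 1)).
have /cvgrPdist_le/(_ _ (divr_gt0 e0 (ltr0Sn _ 1))) [M _ HM] := ul.
apply: filterS (Fu (maxn N M)) => z.
rewrite -ball_normE/= => uz.
rewrite (splitr e) -(subrKA (u (maxn N M))) (le_trans (ler_normD _ _))// lerD//.
  by apply: HM; rewrite /= leq_maxr.
by rewrite ltW// (lt_le_trans uz)// HN// leq_maxl.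
Qed.

Section DualComplete.
Variables (R : realType) (X : normedModType R).

Lemma dual_cauchy_cvg (u : nat -> dual X) : cauchy_seq u -> cvgn u.
Proof.
move=> cu.
have cux x : cvgn (fun n => u n x : R).
  apply: cauchy_cvg; apply/cauchy_exP => _/posnumP[e].
  have d0 : 0 < e%:num / 2 / (`|x| + 1).
    by rewrite divr_gt0// ltr_wpDl.
  have [N HN] := cu _ d0; exists (u N x : R).
  exists N => // n /= Nn; rewrite -ball_normE/=.
  have := dual_norm_ub (u N - u n) x; rewrite /= -[_ (u N) x + _]/(u N x - u n x).
  move=> /le_lt_trans; apply.
  rewrite (@le_lt_trans _ _ (e%:num / 2))//; last by rewrite gtr_pMr// invf_lt1// ltr1n.
  rewrite (le_trans (ler_wpM2r (normr_ge0 x) (HN N n (leqnn _) Nn)))//.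
  have x1 : 0 < `|x| + 1 by rewrite ltr_wpDl.
  by rewrite mulrAC ler_pdivrMr// ler_wpM2l// lerDl.
pose g x : R^o := limn (fun n => u n x : R).
have ug x : (fun n => u n x : R) @ \oo --> (g x : R) by exact: cux.
have gl : linear g.
  move=> a x y; apply: cvg_lim => //.
  rewrite (_ : (fun n => _) = (fun n => a * u n x + u n y)); last first.
    by apply/funext => n; rewrite linearP.
  by apply: cvgD; [apply: cvgMr; exact: ug|exact: ug].
have close e : 0 < e -> exists N, forall n, (N <= n)%N ->
    forall x, `|g x - u n x| <= e * `|x|.
  move=> e0; have [N HN] := cu _ e0; exists N => n Nn x.
  have h : (fun m => `|u m x - u n x|) @ \oo --> `|g x - u n x|.
    by apply: cvg_norm; apply: cvgB; [exact: ug|exact: cvg_cst].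
  rewrite -(cvg_lim _ h)//; apply: limr_le; first by apply/cvg_ex; eexists; exact: h.
  exists N => // m /= Nm.
  have := dual_norm_ub (u m - u n) x; rewrite /= -[_ (u m) x + _]/(u m x - u n x).
  by move/le_trans; apply; rewrite ler_wpM2r//; exact: HN.
pose G : {linear X -> R^o} := HB.pack g (GRing.isLinear.Build _ _ _ _ _ gl).
have gc : continuous g.
  have [N /(_ _ (leqnn N)) HN] := close 1 ltr01.
  apply: (@bounded_linear_continuous _ _ _ G); apply/linear_boundedP.
  exists (1 + dual_norm (u N)); split; first exact: num_real.
  move=> M /ltW ltM x; rewrite (@le_trans _ _ ((1 + dual_norm (u N)) * `|x|))//.
    rewrite -[leLHS]/(`|g x|) -(subrK (u N x : R) (g x)) (le_trans (ler_normD _ _))//.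
    by rewrite mulrDl lerD ?dual_norm_ub.
  by rewrite ler_wpM2r.
have gP : is_dual g by apply/asboolP.
apply/cvg_ex; exists (Dual gP); apply/cvgrPdist_le => e e0.
have [N HN] := close e e0; exists N => // n /= Nn.
by apply: dual_norm_le => [|x]; [exact: ltW|exact: HN].
Qed.

HB.instance Definition _ := Uniform_isComplete.Build (dual X)
  (cauchy_seq_complete dual_cauchy_cvg).

End DualComplete.

Section Completion.
Variables (R : realType) (V : normedModType R).

Definition is_cauchy_seq : {pred nat -> V} := fun u => `[< cauchy_seq u >].

Lemma cauchy_seq_submod_closed : submod_closed is_cauchy_seq.
Proof.
split.
  apply/asboolP => e e0; exists 0%N => m n _ _.
  by rewrite /= subrr normr0 ltW.
move=> a u v /asboolP cu /asboolP cv; apply/asboolP => e e0.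
have a1 : 0 < `|a| + 1 by rewrite ltr_wpDl.
have [N HN] := cu _ (divr_gt0 (divr_gt0 e0 (ltr0Sn _ 1)) a1).
have [M HM] := cv _ (divr_gt0 e0 (ltr0Sn _ 1)).
exists (maxn N M) => m n; rewrite !geq_max => /andP[Nm Mm] /andP[Nn Mn].
rewrite /= !fctE opprD addrACA -scalerBr (splitr e).
rewrite (le_trans (ler_normD _ _))// lerD//; last exact: HM.
rewrite normrZ (le_trans (ler_wpM2l (normr_ge0 a) (HN _ _ Nm Nn)))//.
by rewrite mulrCA ler_piMr ?divr_ge0 ?ltW// ltr_pdivrMr// mul1r ltrDl.
Qed.

HB.instance Definition _ :=
  GRing.isSubmodClosed.Build R (nat -> V) is_cauchy_seq
    cauchy_seq_submod_closed.

Record cauchySeq : Type :=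
  CauchySeq { cauchy_fun :> nat -> V; cauchyP : is_cauchy_seq cauchy_fun }.

HB.instance Definition _ := [isSub for cauchy_fun].
HB.instance Definition _ := [Choice of cauchySeq by <:].
HB.instance Definition _ := [SubChoice_isSubLmodule of cauchySeq by <:].

Implicit Types u v : cauchySeq.

Definition cauchy_norm u : R := limn (fun n => `|u n|).

Lemma cauchy_norm_cvg u : (fun n => `|u n|) @ \oo --> cauchy_norm u.
Proof.
apply: cauchy_cvg; apply/cauchy_exP => _/posnumP[e].
have /asboolP /(_ (e%:num / 2)) [//|N HN] := cauchyP u.
exists `|u N|; exists N => // n /= Nn; rewrite -ball_normE/=.
rewrite (le_lt_trans (ler_dist_dist _ _))//.
rewrite (le_lt_trans (HN N n (leqnn _) Nn))//.
by rewrite gtr_pMr// invf_lt1// ltr1n.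
Qed.

Lemma cauchy_norm_triangle u v :
  cauchy_norm (u + v) <= cauchy_norm u + cauchy_norm v.
Proof.
have h : (fun n => `|u n| + `|v n|) @ \oo --> cauchy_norm u + cauchy_norm v.
  by apply: cvgD; exact: cauchy_norm_cvg.
rewrite -(cvg_lim _ h)//; apply: ler_lim.
- by apply/cvg_ex; eexists; exact: cauchy_norm_cvg.
- by apply/cvg_ex; eexists; exact: h.
- by apply: nearW => n; exact: ler_normD.
Qed.

Lemma cauchy_normZ (a : R) u : cauchy_norm (a *: u) = `|a| * cauchy_norm u.
Proof.
apply: cvg_lim => //.
rewrite (_ : (fun n => _) = (fun n => `|a| * `|u n|)); last first.
  by apply/funext => n; rewrite -normrZ.
by apply: cvgMr; exact: cauchy_norm_cvg.
Qed.

Definition null_seq : {pred cauchySeq} :=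
  fun u => `[< (u : nat -> V) @ \oo --> (0 : V) >].

Lemma null_seqP u : (u \in null_seq) = (cauchy_norm u == 0).
Proof.
apply/asboolP/eqP => [u0|u0].
  by apply: cvg_lim => //; apply/norm_cvg0P.
by apply/norm_cvg0P; rewrite -u0; exact: cauchy_norm_cvg.
Qed.

Lemma cauchy_norm_ge0 u : 0 <= cauchy_norm u.
Proof.
apply: limr_ge; first by apply/cvg_ex; eexists; exact: cauchy_norm_cvg.
exact: nearW.
Qed.

Lemma null_seq_zmod_closed : zmod_closed null_seq.
Proof.
split=> [|u v].
  by rewrite null_seqP -(scale0r 0) cauchy_normZ normr0 mul0r.
rewrite !null_seqP => /eqP u0 /eqP v0.
rewrite eq_le cauchy_norm_ge0 andbT (le_trans (cauchy_norm_triangle _ _))//.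
by rewrite -scaleN1r cauchy_normZ u0 v0 mulr0 addr0.
Qed.

HB.instance Definition _ :=
  GRing.isZmodClosed.Build cauchySeq null_seq null_seq_zmod_closed.

Definition completion : Type := Quotient.quot null_seq.

HB.instance Definition _ := EqQuotient.on completion.
HB.instance Definition _ := GRing.Zmodule.on completion.

Definition cpi (u : cauchySeq) : completion := (\pi_(Quotient.quot null_seq) u)%qT.

Lemma cpiB u v : cpi (u - v) = cpi u - cpi v.
Proof. by rewrite /cpi raddfB. Qed.

Lemma cpiD u v : cpi (u + v) = cpi u + cpi v.
Proof. by rewrite /cpi raddfD. Qed.

Lemma cpi_surj (x : completion) : exists u, x = cpi u.
Proof. by exists (repr (x : Quotient.quot null_seq)); rewrite /cpi reprK. Qed.

Lemma eq_cpi u v : (cpi u = cpi v) <-> cauchy_norm (u - v) = 0.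
Proof.
have := Quotient.idealrBE null_seq u v; rewrite null_seqP => E.
by split => [h|/eqP h]; apply/eqP; [rewrite E; apply/eqP|rewrite -E].
Qed.

Definition crepr (x : completion) : cauchySeq :=
  repr (x : Quotient.quot null_seq).

Lemma creprK x : cpi (crepr x) = x.
Proof. exact: reprK. Qed.

Definition completion_scale (a : R) (x : completion) : completion :=
  cpi (a *: crepr x).

Lemma completion_scaleE a u : completion_scale a (cpi u) = cpi (a *: u).
Proof.
apply/eq_cpi; rewrite -scalerBr cauchy_normZ.
have /eq_cpi -> : cpi (crepr (cpi u)) = cpi u by rewrite creprK.
by rewrite mulr0.
Qed.

Lemma completion_scalerA a b x :
  completion_scale a (completion_scale b x) = completion_scale (a * b) x.
Proof.
by have [u ->] := cpi_surj x; rewrite !completion_scaleE scalerA.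
Qed.

Lemma completion_scale1r : left_id 1 completion_scale.
Proof. by move=> x; have [u ->] := cpi_surj x; rewrite completion_scaleE scale1r. Qed.

Lemma completion_scalerDr : right_distributive completion_scale +%R.
Proof.
move=> a x y; have [u ->] := cpi_surj x; have [v ->] := cpi_surj y.
by rewrite -cpiD !completion_scaleE scalerDr cpiD.
Qed.

Lemma completion_scalerDl x :
  {morph completion_scale^~ x : a b / a + b}.
Proof.
move=> a b; have [u ->] := cpi_surj x.
by rewrite !completion_scaleE scalerDl cpiD.
Qed.

HB.instance Definition _ := GRing.Zmodule_isLmodule.Build R completion
  completion_scalerA completion_scale1r completion_scalerDr
  completion_scalerDl.

Definition completion_norm (x : completion) : R := cauchy_norm (crepr x).

Lemma completion_normE u : completion_norm (cpi u) = cauchy_norm u.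
Proof.
have h v w : cpi v = cpi w -> cauchy_norm v <= cauchy_norm w.
  move=> /eq_cpi vw; rewrite -(subrK w v).
  by rewrite (le_trans (cauchy_norm_triangle _ _))// vw add0r.
by apply/eqP; rewrite eq_le !h// creprK.
Qed.

Lemma completion_norm_triangle x y :
  completion_norm (x + y) <= completion_norm x + completion_norm y.
Proof.
have [u ->] := cpi_surj x; have [v ->] := cpi_surj y.
by rewrite -cpiD !completion_normE cauchy_norm_triangle.
Qed.

Lemma completion_normZ (a : R) x :
  completion_norm (a *: x) = `|a| * completion_norm x.
Proof.
have [u ->] := cpi_surj x.
by rewrite [_ *: _]completion_scaleE !completion_normE cauchy_normZ.
Qed.

Lemma completion_norm0_eq0 x : completion_norm x = 0 -> x = 0.
Proof.
have [u ->] := cpi_surj x; rewrite completion_normE => u0.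
have -> : (0 : completion) = cpi 0 by rewrite /cpi raddf0.
by apply/eq_cpi; rewrite subr0.
Qed.

HB.instance Definition _ := Lmodule_isNormed.Build R completion
  completion_norm_triangle completion_normZ completion_norm0_eq0.

Lemma cst_is_cauchy_seq (v : V) : is_cauchy_seq (fun=> v).
Proof.
by apply/asboolP => e e0; exists 0%N => m n _ _; rewrite subrr normr0 ltW.
Qed.

Definition completion_inj (v : V) : completion :=
  cpi (CauchySeq (cst_is_cauchy_seq v)).

Lemma completion_inj_linear : linear completion_inj.
Proof.
move=> a v w; rewrite [X in _ = X + _]completion_scaleE -cpiD; congr cpi.
exact: val_inj.
Qed.

HB.instance Definition _ :=
  GRing.isLinear.Build R V completion *:%R completion_inj completion_inj_linear.

Lemma completion_inj_norm (v : V) : `|completion_inj v| = `|v|.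
Proof.
by rewrite [LHS]completion_normE /cauchy_norm/= lim_cst.
Qed.

Lemma cpi_cvg u : (fun n => completion_inj (u n)) @ \oo --> cpi u.
Proof.
apply/cvgrPdist_le => e e0; have /asboolP/(_ e e0)[N HN] := cauchyP u.
exists N => // n /= Nn; rewrite /completion_inj -cpiB [leLHS]completion_normE.
apply: limr_le; first by apply/cvg_ex; eexists; exact: cauchy_norm_cvg.
by exists N => // m /= Nm; exact: HN.
Qed.

Lemma completion_inj_dense (x : completion) (e : R) : 0 < e ->
  exists v : V, `|x - completion_inj v| <= e.
Proof.
have [u ->] := cpi_surj x => e0.
have /cvgrPdist_le/(_ e e0)[N _ HN] := @cpi_cvg u.
by exists (u N); exact: HN (leqnn N).
Qed.

Lemma completion_cauchy_cvg (x : nat -> completion) :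
  cauchy_seq x -> cvgn x.
Proof.
move=> cx.
have inv0 n : 0 < n.+1%:R^-1 :> R by rewrite invr_gt0.
have [v xv] := choice (fun n => completion_inj_dense (x n) (inv0 n)).
have small (e : R) : 0 < e -> exists N, forall n, (N <= n)%N -> n.+1%:R^-1 <= e.
  move=> e0; exists (Num.truncn e^-1) => n Nn.
  rewrite invf_ple ?posrE// ltW//.
  by rewrite (lt_le_trans (truncnS_gt _))// ler_nat ltnS.
have cv : is_cauchy_seq v.
  apply/asboolP => e e0; have e3 : 0 < e / 3 by rewrite divr_gt0.
  have [N HN] := small _ e3; have [M HM] := cx _ e3.
  exists (maxn N M) => m n; rewrite !geq_max => /andP[Nm Mm] /andP[Nn Mn].
  rewrite -completion_inj_norm linearB/=.
  have -> : e = e / 3 + (e / 3 + e / 3) by lra.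
  rewrite -(subrKA (x m)) (le_trans (ler_normD _ _))// lerD//.
    by rewrite distrC (le_trans (xv m))// HN.
  rewrite -(subrKA (x n)) (le_trans (ler_normD _ _))// lerD//; first exact: HM.
  by rewrite (le_trans (xv n))// HN.
apply/cvg_ex; exists (cpi (CauchySeq cv)); apply/cvgrPdist_le => e e0.
have e2 : 0 < e / 2 by rewrite divr_gt0.
have [N HN] := small _ e2.
have /cvgrPdist_le/(_ _ e2)[M _ HM] := @cpi_cvg (CauchySeq cv).
exists (maxn N M) => // n /=; rewrite geq_max => /andP[Nn Mn].
rewrite (splitr e) -(subrKA (completion_inj (v n))).
rewrite (le_trans (ler_normD _ _))// lerD//; first exact: HM.
by rewrite distrC (le_trans (xv n))// HN.
Qed.

HB.instance Definition _ := Uniform_isComplete.Build completion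
  (cauchy_seq_complete completion_cauchy_cvg).

End Completion.

Section Tsirelson.
Variable R : realType.

Definition is_c00 : {pred nat -> R^o} :=
  fun x => `[< finite_set [set i | x i != 0] >].

Lemma c00_submod_closed : submod_closed is_c00.
Proof.
split.
  apply/asboolP; rewrite (_ : [set _ | _] = set0)//.
  by apply/seteqP; split=> // i /=; rewrite eqxx.
move=> a x y /asboolP xf /asboolP yf; apply/asboolP.
apply: (@sub_finite_set _ _ ([set i | x i != 0] `|` [set i | y i != 0])).
  move=> i /=; rewrite !fctE; have [->|] := eqVneq (x i) 0; last by left.
  by rewrite scaler0 add0r; right.
by rewrite finite_setU.
Qed.

HB.instance Definition _ :=
  GRing.isSubmodClosed.Build R (nat -> R^o) is_c00 c00_submod_closed.

Record c00 : Type := C00 { c00_fun :> nat -> R^o; c00P : is_c00 c00_fun }.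

HB.instance Definition _ := [isSub for c00_fun].
HB.instance Definition _ := [Choice of c00 by <:].
HB.instance Definition _ := [SubChoice_isSubLmodule of c00 by <:].

Implicit Types (x y : c00) (p N : c00 -> R).

Lemma restr_subproof (E : {fset nat}) x :
  is_c00 (fun i => if i \in E then x i else 0).
Proof.
have /asboolP xf := c00P x; apply/asboolP; apply: sub_finite_set xf => i /=.
by case: ifP => //; rewrite eqxx.
Qed.

Definition restr (E : {fset nat}) x : c00 := C00 (restr_subproof E x).

(* The index i : nat stands for the positive integer i.+1; hence the condition
   k <= min (E 0) on positive integers becomes k <= a.+1 for all a in E 0.
   Comparing consecutive blocks is enough as the blocks are nonempty. *)
Definition admissible (k : nat) (E : nat -> {fset nat}) : Prop :=
  [/\ (0 < k)%N,
      forall i, (i < k)%N -> E i != fset0,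
      forall i a b, (i.+1 < k)%N -> a \in E i -> b \in E i.+1 -> (a < b)%N &
      forall a, a \in E 0%N -> (k <= a.+1)%N].

Definition is_norm N : Prop :=
  [/\ forall x y, N (x + y) <= N x + N y,
      forall a x, N (a *: x) = `|a| * N x &
      forall x, N x = 0 -> x = 0].

Definition tsirelson_eq N : Prop := forall x,
  ((N x)%:E = maxe (ereal_sup [set `|x i|%:E | i in [set: nat]])
    (2^-1%:E * ereal_sup [set (\sum_(i < kE.1) N (restr (kE.2 i) x))%:E |
                           kE in [set kE | admissible kE.1 kE.2]]))%E.

Lemma admissible_lt k E i j a b : admissible k E -> (i < j)%N -> (j < k)%N ->
  a \in E i -> b \in E j -> (a < b)%N.
Proof.
move=> [k0 En Elt _] + + aE; elim: j b => // j IH b.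
rewrite ltnS leq_eqVlt => /predU1P[<-|ij] jk bE; first exact: (Elt _ _ _ jk aE bE).
have /fset0Pn[c cE] := En j (ltnW jk).
exact: ltn_trans (IH c ij (ltnW jk) cE) (Elt _ _ _ jk cE bE).
Qed.

Lemma c00_bounded_supp x : exists n, forall i, (n <= i)%N -> x i = 0.
Proof.
have /asboolP/finite_fsetP[A xA] := c00P x.
exists (\max_(i <- A) i).+1 => i Ai; apply/eqP/negP => /negP xi.
have : i \in A by have : [set` A] i by rewrite -xA.
move=> iA; move: Ai; rewrite ltnNge => /negP; apply; exact: leq_bigmax_seq.
Qed.

Section Existence.

Definition le_l1 p := forall x n, (forall i, (n <= i)%N -> x i = 0) ->
  p x <= \sum_(i < n) `|x i|.

Definition tset p x : set R := [set `|x i| | i in [set: nat]] `|`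
  [set 2^-1 * (\sum_(i < kE.1) p (restr (kE.2 i) x)) |
                           kE in [set kE | admissible kE.1 kE.2]].

Definition titer p x : R := sup (tset p x).

Lemma tset_le_l1 p x n : le_l1 p -> (forall i, (n <= i)%N -> x i = 0) ->
  ubound (tset p x) (\sum_(i < n) `|x i|).
Proof.
move=> pl1 xn _ [[i _ <-]|[[k E] /= kE <-]].
  have [ni|ni] := leqP n i; first by rewrite xn// normr0 sumr_ge0.
  by rewrite (bigD1 (Ordinal ni))//= lerDl sumr_ge0.
rewrite mulrC ler_pdivrMr// (@le_trans _ _ (\sum_(i < n) `|x i|))//; last first.
  by rewrite ler_peMr ?sumr_ge0// ler1n.
apply: (@le_trans _ _ (\sum_(j < k) \sum_(i < n) `|restr (E j) x i|)).
  apply: ler_sum => j _; apply: pl1 => i ni /=; by rewrite xn//; case: ifP.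
rewrite exchange_big/=; apply: ler_sum => i _.
have [[j ij]|H] := pselect (exists j : 'I_k, (i : nat) \in E j); last first.
  rewrite big1// => j _; case: ifPn => [ij|]; last by rewrite normr0.
  by exfalso; apply: H; exists j.
rewrite (bigD1 j)//= ij big1 ?addr0// => l lj.
case: ifPn => [il|]; last by rewrite normr0.
have := lj; rewrite neq_ltn => /orP[h|h].
  by have := admissible_lt kE h (ltn_ord _) il ij; rewrite ltnn.
by have := admissible_lt kE h (ltn_ord _) ij il; rewrite ltnn.
Qed.

Lemma tset_has_sup p x : le_l1 p -> has_sup (tset p x).
Proof.
move=> pl1; split; first by exists `|x 0%N|; left; exists 0%N.
have [n xn] := c00_bounded_supp x.
by exists (\sum_(i < n) `|x i|); exact: tset_le_l1.
Qed.

Lemma titer_le p x M : ubound (tset p x) M -> titer p x <= M.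
Proof. by apply: ge_sup; exists `|x 0%N|; left; exists 0%N. Qed.

Lemma titer_ub_coord p x i : le_l1 p -> `|x i| <= titer p x.
Proof.
by move=> pl1; apply: (sup_upper_bound (tset_has_sup x pl1)); left; exists i.
Qed.

Lemma titer_ub_sum p x k E : le_l1 p -> admissible k E ->
  2^-1 * (\sum_(i < k) p (restr (E i) x)) <= titer p x.
Proof.
move=> pl1 kE; apply: (sup_upper_bound (tset_has_sup x pl1)).
by right; exists (k, E).
Qed.

Lemma titer_le_l1 p : le_l1 p -> le_l1 (titer p).
Proof. by move=> pl1 x n xn; apply: titer_le; exact: tset_le_l1. Qed.

Definition triangle p := forall x y, p (x + y) <= p x + p y.
Definition homog p := forall (a : R) x, p (a *: x) <= `|a| * p x.

Lemma restrD E x y : restr E (x + y) = restr E x + restr E y.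
Proof.
by apply/val_inj/funext => i /=; rewrite !fctE; case: ifP; rewrite ?addr0.
Qed.

Lemma restrZ E a x : restr E (a *: x) = a *: restr E x.
Proof.
by apply/val_inj/funext => i /=; rewrite !fctE; case: ifP; rewrite ?scaler0.
Qed.

Lemma titer_triangle p : le_l1 p -> triangle p -> triangle (titer p).
Proof.
move=> pl1 pt x y; apply: titer_le => _ [[i _ <-]|[[k E] /= kE <-]].
  by rewrite (le_trans (ler_normD _ _))// lerD// titer_ub_coord.
apply: (@le_trans _ _ (2^-1 * (\sum_(i < k) p (restr (E i) x)) +
                       2^-1 * (\sum_(i < k) p (restr (E i) y)))).
  rewrite -mulrDr ler_wpM2l// -big_split/=; apply: ler_sum => i _.
  by rewrite restrD.
by rewrite lerD// titer_ub_sum.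
Qed.

Lemma titer_homog p : le_l1 p -> homog p -> homog (titer p).
Proof.
move=> pl1 ph a x; apply: titer_le => _ [[i _ <-]|[[k E] /= kE <-]].
  by rewrite normrM ler_wpM2l// titer_ub_coord.
apply: (@le_trans _ _ (`|a| * (2^-1 * (\sum_(i < k) p (restr (E i) x))))).
  rewrite mulrCA ler_wpM2l// mulr_sumr; apply: ler_sum => i _.
  by rewrite restrZ.
by rewrite ler_wpM2l// titer_ub_sum.
Qed.

Lemma titer_homo p q : le_l1 q -> (forall x, p x <= q x) ->
  forall x, titer p x <= titer q x.
Proof.
move=> ql1 pq x; apply: titer_le => _ [[i _ <-]|[[k E] /= kE <-]].
  exact: titer_ub_coord.
apply: le_trans (titer_ub_sum x ql1 kE).
by rewrite ler_wpM2l//; apply: ler_sum.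
Qed.

(* The Tsirelson norm is the largest seminorm p below the l1 norm satisfying
   p <= titer p. *)
Definition subsol : set (c00 -> R) :=
  [set p | [/\ le_l1 p, triangle p, homog p & forall x, p x <= titer p x]].

Definition tsup x : R := sup [set p x | p in subsol].

Lemma subsol_zero : subsol (fun=> 0).
Proof.
have z : le_l1 (fun=> 0) by move=> x n _; rewrite sumr_ge0.
split=> [//|x y|a x|x]; [by rewrite addr0|by rewrite mulr0|].
by apply: le_trans (titer_ub_coord x 0 z).
Qed.

Lemma tsup_has_sup x : has_sup [set p x | p in subsol].
Proof.
split; first by exists 0, (fun=> 0) => //; exact: subsol_zero.
have [n xn] := c00_bounded_supp x.
by exists (\sum_(i < n) `|x i|) => _ [p [pl1 _ _ _] <-]; exact: pl1.
Qed.

Lemma tsup_ub p x : subsol p -> p x <= tsup x.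
Proof. by move=> sp; apply: (sup_upper_bound (tsup_has_sup x)); exists p. Qed.

Lemma tsup_le x M : (forall p, subsol p -> p x <= M) -> tsup x <= M.
Proof.
by move=> h; apply: ge_sup => [|_ [p sp <-]]; [exact: (tsup_has_sup x).1|exact: h].
Qed.

Lemma subsol_tsup : subsol tsup.
Proof.
have l1 : le_l1 tsup by move=> x n xn; apply: tsup_le => p [pl1 _ _ _]; exact: pl1.
split=> // [x y|a x|x]; apply: tsup_le => p sp.
- have [_ pt _ _] := sp.
  by rewrite (le_trans (pt _ _))// lerD// tsup_ub.
- have [_ _ ph _] := sp.
  by rewrite (le_trans (ph _ _))// ler_wpM2l// tsup_ub.
- have [_ _ _ ps] := sp.
  by rewrite (le_trans (ps _))//; apply: titer_homo => // z; exact: tsup_ub.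
Qed.

Lemma titer_tsup x : titer tsup x = tsup x.
Proof.
have [l1 t h s] := subsol_tsup.
apply/eqP; rewrite eq_le s andbT; apply: tsup_ub; split.
- exact: titer_le_l1.
- exact: titer_triangle.
- exact: titer_homog.
- by move=> z; apply: titer_homo => //; exact: titer_le_l1.
Qed.

Lemma tsup_is_norm : is_norm tsup.
Proof.
have [l1 t h s] := subsol_tsup; split=> // [a x|x x0].
  apply/eqP; rewrite eq_le h/=.
  have [->|a0] := eqVneq a 0.
    by rewrite normr0 mul0r; exact: (tsup_ub _ subsol_zero).
  rewrite -{1}[x](scalerK a0) -ler_pdivlMl ?normr_gt0// -normfV.
  exact: h.
apply/val_inj/funext => i /=; apply/eqP.
by rewrite -normr_le0 -x0 -titer_tsup titer_ub_coord.
Qed.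

Lemma tsup_eq : tsirelson_eq tsup.
Proof.
have [l1 _ _ _] := subsol_tsup.
move=> x; apply/eqP; rewrite eq_le; apply/andP; split.
  rewrite -titer_tsup -ereal_sup_EFin; last 2 first.
  - exact: (tset_has_sup x l1).2.
  - exact: (tset_has_sup x l1).1.
  apply: ge_ereal_sup => _ [_ [[i _ <-]|[kE h <-]] <-]; rewrite le_max.
    by apply/orP; left; apply: ereal_sup_ubound; exists i.
  apply/orP; right; rewrite EFinM lee_pmul2l//.
  by apply: ereal_sup_ubound; exists kE.
rewrite ge_max; apply/andP; split.
  apply: ge_ereal_sup => _ [i _ <-].
  by rewrite lee_fin -titer_tsup titer_ub_coord.
rewrite -lee_pdivlMl//; apply: ge_ereal_sup => _ [[k E] /= kE <-].
rewrite -EFinM lee_fin -ler_pdivrMl ?invr_gt0// invrK -titer_tsup.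
exact: titer_ub_sum.
Qed.

End Existence.

Lemma is_norm_ge0 N x : is_norm N -> 0 <= N x.
Proof.
move=> [Nt Nh _].
have := Nt x (- x); rewrite subrr -scaleN1r Nh normrN1 mul1r.
by rewrite -(scale0r x) Nh normr0 mul0r -mulr2n pmulrn_lge0.
Qed.

Lemma tsirelson_eq_coord N x i : tsirelson_eq N -> `|x i| <= N x.
Proof.
move=> /(_ x) Nx; rewrite -lee_fin Nx le_max; apply/orP; left.
by apply: ereal_sup_ubound; exists i.
Qed.

Lemma tsirelson_eq_sum N x k E : tsirelson_eq N -> admissible k E ->
  2^-1 * (\sum_(i < k) N (restr (E i) x)) <= N x.
Proof.
move=> /(_ x) Nx kE; rewrite -lee_fin Nx le_max; apply/orP; right.
by rewrite EFinM lee_pmul2l//; apply: ereal_sup_ubound; exists (k, E).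
Qed.

Lemma tsirelson_eq_le N x M : tsirelson_eq N -> (forall i, `|x i| <= M) ->
  (forall k E, admissible k E ->
    2^-1 * (\sum_(i < k) N (restr (E i) x)) <= M) ->
  N x <= M.
Proof.
move=> /(_ x) Nx xM kEM; rewrite -lee_fin Nx ge_max; apply/andP; split.
  by apply: ge_ereal_sup => _ [i _ <-]; rewrite lee_fin.
rewrite -lee_pdivlMl//; apply: ge_ereal_sup => _ [[k E] /= kE <-].
by rewrite -EFinM lee_fin -ler_pdivrMl ?invr_gt0// invrK; exact: kEM.
Qed.

Lemma tsirelson_norm_unique N N' : is_norm N -> tsirelson_eq N ->
  is_norm N' -> tsirelson_eq N' -> N = N'.
Proof.
suff le M M' : is_norm M -> tsirelson_eq M -> is_norm M' -> tsirelson_eq M' ->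
    forall x, M x <= M' x.
  by move=> *; apply/funext => x; apply/eqP; rewrite eq_le !le.
move=> nM eM nM' eM' x.
have [n xn] := c00_bounded_supp x.
have [m] := ubnP #|[set i : 'I_n | x i != 0]|%SET.
elim: m => // m IH in x xn *; rewrite ltnS => xm.
have M0 : M 0 = 0.
  by have [_ Mh _] := nM; rewrite -(scale0r 0) Mh normr0 mul0r.
suff : M x <= Num.max (M' x) (2^-1 * M x).
  rewrite le_max => /orP[//|]; rewrite -subr_ge0 -{2}[M x]mul1r -mulrBl.
  have -> : 2^-1 - 1 = - 2^-1 :> R by lra.
  rewrite mulNr oppr_ge0 pmulr_rle0// => Mx0.
  by apply: le_trans Mx0 _; exact: is_norm_ge0.
apply: tsirelson_eq_le => // [i|k E kE].
  by rewrite le_max tsirelson_eq_coord.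
have [[j jx]|H] := pselect (exists j : 'I_k, restr (E j) x = x).
  rewrite le_max; apply/orP; right; rewrite ler_wpM2l//.
  rewrite (bigD1 j)//= jx big1 ?addr0// => l lj.
  rewrite -[RHS]M0; congr M; apply/val_inj/funext => i /=.
  case: ifPn => // il; rewrite -jx /=; case: ifPn => // ij.
  have := lj; rewrite neq_ltn => /orP[h|h].
    by have := admissible_lt kE h (ltn_ord _) il ij; rewrite ltnn.
  by have := admissible_lt kE h (ltn_ord _) ij il; rewrite ltnn.
rewrite le_max; apply/orP; left.
apply: le_trans (tsirelson_eq_sum x eM' kE); rewrite ler_wpM2l//.
apply: ler_sum => j _; apply: IH => [i ni|] /=; first by rewrite xn// if_same.
apply: leq_trans xm; apply: proper_card; apply/properP; split.
  by apply/fintype.subsetP => i; rewrite !inE; case: ifP => //; rewrite eqxx.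
have [i] : exists i, restr (E j) x i <> x i.
  by apply/existsNP => h; apply: H; exists j; apply/val_inj/funext.
rewrite /=; case: ifPn => // iE /eqP; rewrite eq_sym => xi.
have ni : (i < n)%N by rewrite ltnNge; apply/negP => /xn xi0; rewrite xi0 eqxx in xi.
by exists (Ordinal ni); rewrite !inE//= (negbTE iE) eqxx.
Qed.

Lemma tsirelson_norm_exists : exists N, is_norm N /\ tsirelson_eq N.
Proof. by exists tsup; split; [exact: tsup_is_norm|exact: tsup_eq]. Qed.

Definition tsirelson_norm : c00 -> R := projT1 (cid tsirelson_norm_exists).

Lemma tsirelson_norm_is_norm : is_norm tsirelson_norm.
Proof. exact: (projT2 (cid tsirelson_norm_exists)).1. Qed.

Lemma tsirelson_normE : tsirelson_eq tsirelson_norm.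
Proof. exact: (projT2 (cid tsirelson_norm_exists)).2. Qed.

Definition tsirelson_c00 : Type := c00.

HB.instance Definition _ := GRing.Lmodule.on tsirelson_c00.
HB.instance Definition _ := Lmodule_isNormed.Build R tsirelson_c00
  (let: And3 h _ _ := tsirelson_norm_is_norm in h)
  (let: And3 _ h _ := tsirelson_norm_is_norm in h)
  (let: And3 _ _ h := tsirelson_norm_is_norm in h).

Lemma tsirelson_c00_normE (x : tsirelson_c00) : `|x| = tsirelson_norm x.
Proof. by []. Qed.

Definition tsirelson_space : completeNormedModType R :=
  completion tsirelson_c00.

End Tsirelson.

(* Main.v *)
From HB Require Import structures.
Require Import Defs.
From mathcomp Require Import all_boot all_order all_algebra finmap.
From mathcomp Require Import all_classical all_reals all_analysis.
From mathcomp Require Import lra zify.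

Set Implicit Arguments.
Unset Strict Implicit.
Unset Printing Implicit Defensive.

Import Order.TTheory GRing.Theory Num.Theory.
Import numFieldNormedType.Exports.

Local Open Scope classical_set_scope.
Local Open Scope ring_scope.

(** The dual of Tsirelson's space is asymptotically c_0 with constant 2: if
    z = y_0 + ... + y_(t-1), where the y_i have norm at most r and live on
    successive intervals of coordinates starting after t, then testing z on x
    only sees the restrictions of x to t admissible intervals, whose norms add
    up to at most 2 |x| by the implicit equation of the norm, so |z| <= 2 r.

    Suppose that closed convex sets A_0, ..., A_(n-1) of essential inradius
    less than r < 1/2 cover the unit ball of the dual.  Start from z = 0.
    While z has norm at most 1, it lies in some A_k; as the inradius of A_k is
    less than r, every closed subspace Y of finite codimension contains some y
    of norm at most r with z + y outside A_k.  A functional L separates z + y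
    from A_k, and if all the later increments are taken in the kernel of L the
    walk never enters A_k again.  The same freedom in the choice of Y lets the
    new y vanish on any prescribed initial segment of coordinates, so that the
    increments are successive blocks up to small tails and the walk stays in
    the unit ball.  After n steps it has left all the A_k for good, which is
    absurd ([greedy_escape], [covering_index_ge]).

    Increments of arbitrary elements of the dual are close to finite blocks
    because the unit vector basis of Tsirelson's space is shrinking: the norms
    of the tails of a functional g tend to 0 ([tail_bounded_small]).  If the
    tails of g could not be brought below 9/10 of a bound C, unit blocks u_i
    with g (u_i) >= 9/10 C would exist arbitrarily far; but one block plus the
    average of 2 m later ones, with m the end of the first block, has norm at
    most 7/4, since an admissible family that meets the first block has at most
    m members, hence splits at most m of the later blocks ([norm_blocks]).  Then
    2 (9/10) C <= (7/4) C, a contradiction.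

    The separation comes from the existence of minimal sublinear functionals,
    which are linear ([linear_below_sublinear]). *)

(** * Separation by a continuous linear functional *)

Section HahnBanach.
Variables (R : realType) (V : lmodType R).
Implicit Types (p q : V -> R) (A : set V).

Definition sublinear p : Prop :=
  (forall x y, p (x + y) <= p x + p y) /\
  (forall t x, 0 < t -> p (t *: x) <= t * p x).

Lemma sublinearZ p t x : sublinear p -> 0 <= t -> p (t *: x) = t * p x.
Proof.
move=> [pD pZ]; rewrite le_eqVlt => /predU1P[<-|t0].
  rewrite scale0r mul0r; have := pD 0 0; rewrite addr0.
  have := pZ 2^-1 0; rewrite scaler0 invr_gt0 ltr0n => /(_ isT); lra.
apply/eqP; rewrite eq_le pZ//= -ler_pdivlMl//.
by rewrite (le_trans _ (pZ _ _ _)) ?invr_gt0// scalerK ?gt_eqF.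
Qed.

Lemma sublinear0 p : sublinear p -> p 0 = 0.
Proof. by move=> sp; rewrite -(scale0r 0) (sublinearZ _ sp)// mul0r. Qed.

Lemma sublinearN_le p x : sublinear p -> - p (- x) <= p x.
Proof.
move=> sp; have := sp.1 x (- x); rewrite subrr (sublinear0 sp); lra.
Qed.

Definition shift_set p A (d : R) x : set R :=
  [set p (x + ta.1 *: ta.2) - ta.1 * d | ta in [set ta : R * V | 0 <= ta.1 /\ A ta.2]].

(** Lowers p as far as possible in the directions - a, for a in A: the largest
    sublinear functional q below p with q (- a) <= - d for all these a. *)
Definition shift p A d x : R := inf (shift_set p A d x).

Section Shift.
Variables (p : V -> R) (A : set V) (d : R).
Hypotheses (sp : sublinear p) (cA : convex_set A) (pA : forall a, A a -> d <= p a).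

Let shift_lb x : lbound (shift_set p A d x) (- p (- x)).
Proof.
move=> _ [[t a] /= [t0 Aa] <-].
have := sp.1 (x + t *: a) (- x); rewrite addrAC subrr add0r.
rewrite (sublinearZ _ sp)//; have := ler_wpM2l t0 (pA Aa); lra.
Qed.

Lemma shift_le x t a : 0 <= t -> A a -> shift p A d x <= p (x + t *: a) - t * d.
Proof.
move=> t0 Aa; apply: ge_inf; first by exists (- p (- x)); exact: shift_lb.
by exists (t, a).
Qed.

Hypothesis A0 : A !=set0.

Lemma le_shift x M :
  (forall t a, 0 <= t -> A a -> M <= p (x + t *: a) - t * d) -> M <= shift p A d x.
Proof.
move=> h; apply: lb_le_inf.
  by have [a Aa] := A0; exists (p (x + 0 *: a) - 0 * d), (0, a).
by move=> _ [[t a] /= [t0 Aa] <-]; exact: h.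
Qed.

Lemma shift_le_self x : shift p A d x <= p x.
Proof.
have [a Aa] := A0; rewrite (le_trans (shift_le x (lexx 0) Aa))//.
by rewrite scale0r addr0 mul0r subr0.
Qed.

Lemma shiftN_le a : A a -> shift p A d (- a) <= - d.
Proof.
move=> Aa; rewrite (le_trans (shift_le (- a) ler01 Aa))//.
by rewrite scale1r addNr (sublinear0 sp) mul1r sub0r.
Qed.

(** Convexity says that the cone over A is closed under addition; the statement
    includes s + t = 0, which spares a case distinction in the triangle
    inequality for [shift]. *)
Lemma convex_set_combine s t a b : A a -> A b -> 0 <= s -> 0 <= t ->
  exists2 c, A c & s *: a + t *: b = (s + t) *: c.
Proof.
move=> Aa Ab s0 t0; have [st0|st0] := eqVneq (s + t) 0.
  exists a => //; rewrite st0 scale0r.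
  have -> : s = 0 by lra.
  have -> : t = 0 by lra.
  by rewrite !scale0r addr0.
have stp : 0 < s + t by rewrite lt_neqAle eq_sym st0 addr_ge0.
have l01 : 0 <= s / (s + t) <= 1.
  by rewrite (divr_ge0 s0 (ltW stp))/= ler_pdivrMr// mul1r lerDl.
pose l := Itv01 (andP l01).1 (andP l01).2.
exists (s / (s + t) *: a + (1 - s / (s + t)) *: b).
  by have := @cA a b l; rewrite !inE; apply.
rewrite scalerDr !scalerA mulrBr mulr1 mulrCA divff// mulr1.
by congr (_ + _ *: _); lra.
Qed.

Lemma shift_sublinear : sublinear (shift p A d).
Proof.
split=> [x y|t x t0].
  rewrite -lerBlDr; apply: le_shift => t a t0 Aa.
  rewrite lerBlDr -lerBlDl; apply: le_shift => s b s0 Ab.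
  have [c Ac E] := convex_set_combine Aa Ab t0 s0.
  have := shift_le (x + y) (addr_ge0 t0 s0) Ac; rewrite -E addrACA mulrDl.
  have := sp.1 (x + t *: a) (y + s *: b); lra.
rewrite mulrC -ler_pdivrMr//; apply: le_shift => s a s0 Aa.
rewrite ler_pdivrMr// mulrBl mulrC -(sublinearZ _ sp (ltW t0)) scalerDr scalerA.
by rewrite mulrAC [s * t]mulrC shift_le// mulr_ge0// ltW.
Qed.

End Shift.

(** By Zorn's lemma: along a chain the pointwise infimum is again sublinear,
    because two members of the chain can be replaced by the smaller one, and it
    is finite because of the common lower bound - p (- x). *)
Lemma minimal_sublinear p : sublinear p -> exists q,
  [/\ sublinear q, forall x, q x <= p x &
      forall r, sublinear r -> (forall x, r x <= q x) -> r = q].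
Proof.
move=> sp.
pose T := {q : V -> R | sublinear q /\ forall x, q x <= p x}.
pose ge (q r : T) := `[< forall x, sval r x <= sval q x >].
have eqT (q r : T) : sval q = sval r -> q = r.
  by case: q r => q qP [r rP] /= E; subst r; congr exist; exact: Prop_irrelevance.
have lbT (q : T) x : - p (- x) <= sval q x.
  case: q => q [sq qp] /=; rewrite (le_trans _ (sublinearN_le x sq))//.
  by rewrite lerN2.
have [||||q qmin] := @Zorn T ge.
- by move=> q; apply/asboolP.
- by move=> q r s /asboolP qr /asboolP rs; apply/asboolP => x; exact: le_trans (qr x).
- move=> q r /asboolP qr /asboolP rq; apply/eqT/funext => x.
  by apply/eqP; rewrite eq_le qr rq.
- move=> A Atot; have [->|/set0P[q0 Aq0]] := eqVneq A set0.
    by exists (exist _ p (conj sp (fun=> lexx _))).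
  pose m x := inf [set sval q x | q in A].
  have m_le (q : T) x : A q -> m x <= sval q x.
    move=> Aq; apply: ge_inf; last by exists q.
    by exists (- p (- x)) => _ [r _ <-].
  have le_m M x : (forall q : T, A q -> M <= sval q x) -> M <= m x.
    move=> h; apply: lb_le_inf; first by exists (sval q0 x), q0.
    by move=> _ [q Aq <-]; exact: h.
  have sm : sublinear m.
    split=> [x y|t x t0].
      rewrite -lerBlDr; apply: (le_m) => q Aq.
      rewrite lerBlDr -lerBlDl; apply: (le_m) => r Ar.
      rewrite lerBlDr.
      have [/asboolP qr|/asboolP rq] := Atot _ _ Aq Ar.
        rewrite (le_trans (m_le r _ Ar))// (le_trans ((svalP r).1.1 _ _))//.
        by rewrite addrC lerD.
      rewrite (le_trans (m_le q _ Aq))// (le_trans ((svalP q).1.1 _ _))//.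
      by rewrite addrC lerD.
    rewrite mulrC -ler_pdivrMr//; apply: (le_m) => q Aq.
    by rewrite ler_pdivrMr// mulrC (le_trans (m_le q _ Aq))// (svalP q).1.2.
  have mp x : m x <= p x by rewrite (le_trans (m_le q0 x Aq0))// (svalP q0).2.
  by exists (exist _ m (conj sm mp)) => q Aq; apply/asboolP => x; exact: m_le.
exists (sval q); split=> [||r sr rq]; [exact: (svalP q).1|exact: (svalP q).2|].
have rp x : r x <= p x by rewrite (le_trans (rq x))// (svalP q).2.
have /(congr1 sval) : exist _ r (conj sr rp) = q by apply: qmin; apply/asboolP.
by [].
Qed.

(** A minimal sublinear q is linear.  Its [shift] by the singleton of a, with
    d = q a, is sublinear and below q, hence equal to q; this gives
    q x <= q (x + a) - q a, the converse of the triangle inequality. *)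
Lemma linear_below_sublinear p : sublinear p ->
  exists2 L : V -> R^o, linear L & forall x, L x <= p x.
Proof.
move=> sp; have [q [sq qp qmin]] := minimal_sublinear sp; exists q => //.
have superadd x a : q x + q a <= q (x + a).
  have q_shift : shift q [set a] (q a) = q.
    apply: qmin => [|y].
      apply: shift_sublinear => //; [|by move=> _ ->|by exists a].
      by move=> u v l; rewrite !inE => -> ->; exact: (convmm l (a : convex_lmodType V)).
    by apply: shift_le_self; [exact: sq|move=> _ ->|exists a].
  have qa b : [set a] b -> q a <= q b by move=> ->.
  have := shift_le sq qa x ler01 (erefl a).
  by rewrite q_shift scale1r mul1r; lra.
have qD x y : q (x + y) = q x + q y.
  by apply/eqP; rewrite eq_le sq.1 superadd.
have qN x : q (- x) = - q x.
  by apply/eqP; rewrite -addr_eq0 -qD addNr (sublinear0 sq).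
move=> t x y; rewrite qD; congr (_ + _).
have [t0|t0] := leP 0 t; first exact: sublinearZ.
rewrite -[t]opprK scaleNr qN (sublinearZ _ sq); last by rewrite oppr_ge0 ltW.
by rewrite scaleNr.
Qed.

(** The linear functional is found below [shift p A d] instead of p, which
    forces L (- a) <= - d. *)
Lemma linear_below_separating p A d : sublinear p -> convex_set A -> A !=set0 ->
  (forall a, A a -> d <= p a) ->
  exists L : V -> R^o,
    [/\ linear L, forall x, L x <= p x & forall a, A a -> d <= L a].
Proof.
move=> sp cA A0 pA.
have [L linL Lp] := linear_below_sublinear (shift_sublinear sp cA pA A0).
exists L; split=> // [x|a Aa]; first by rewrite (le_trans (Lp x))// shift_le_self.
pose Ll : {linear V -> R^o} := HB.pack L (GRing.isLinear.Build _ _ _ _ _ linL).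
have := Lp (- a); have := shiftN_le sp pA Aa.
by rewrite -[L (- a)]/(Ll (- a)) linearN/= => h1 h2; rewrite -lerN2 (le_trans h2).
Qed.

End HahnBanach.

(** * Closed subspaces of finite codimension *)

Section FiniteCodimension.
Variables (R : realType) (X : completeNormedModType R).
Implicit Types (A Y : set X) (L : dual X).

(** The separation is carried out for the translate A - z, which stays at a
    positive distance d from 0, with the norm as dominating functional. *)
Lemma separating_functional A z : closed A -> convex_set A -> ~ A z ->
  exists L, forall a, A a -> L a != L z.
Proof.
move=> clA cA zA; have [->|/set0P A0] := eqVneq A set0; first by exists 0.
have [d d0 dA] : exists2 d : R, 0 < d & forall a, A a -> d <= `|a - z|.
  have /nbhs_ballP[d /= d0 zd] : nbhs z (~` A).
    by apply: open_nbhs_nbhs; split=> //; rewrite openC.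
  exists d => // a Aa; rewrite leNgt; apply/negP => az.
  by apply: (zd a) => //; rewrite -ball_normE/= distrC.
have snorm : sublinear (fun x : X => `|x|).
  split=> [x y|t x t0]; first exact: ler_normD.
  by rewrite normrZ gtr0_norm.
have cAz : convex_set [set a - z | a in A].
  move=> _ _ l /set_mem[a Aa <-] /set_mem[b Ab <-]; apply/mem_set.
  exists (conv l (a : convex_lmodType X) b).
    by apply/set_mem/cA; exact/mem_set.
  rewrite /conv/= !scalerBr addrACA -opprD -scalerDl.
  by rewrite /unstable.onem [_ + (1 - _)]addrC subrK scale1r.
have [||L [linL Lp Ld]] := linear_below_separating (d := d) snorm cAz.
- by have [a Aa] := A0; exists (a - z), a.
- by move=> _ [a Aa <-]; exact: dA.
pose Ll : {linear X -> R^o} := HB.pack L (GRing.isLinear.Build _ _ _ _ _ linL).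
have Lc : continuous L.
  apply: (@bounded_linear_continuous _ _ _ Ll); apply/linear_boundedP.
  exists 1; split; first exact: num_real.
  move=> M M1 x; apply: (@le_trans _ _ `|x|); last by rewrite ler_peMl// ltW.
  rewrite ler_norml Lp andbT lerNl -normrN.
  by rewrite -[_ x]/(Ll x) -linearN Lp.
have LP : is_dual L by apply/asboolP.
exists (Dual LP) => a Aa; rewrite -subr_eq0 /= -[L a - L z]/(Ll a - Ll z) -linearB.
by rewrite gt_eqF// (lt_le_trans d0)// Ld//; exists a.
Qed.

(** Unfolds the boolean membership used by the algebraic closure predicate into
    membership in a classical set. *)
Lemma submod_closed_setP Y : submod_closed (fun x => x \in Y) <->
  Y 0 /\ forall a x y, Y x -> Y y -> Y (a *: x + y).
Proof.
have E x : (x \in (fun y => y \in Y)) = (x \in Y) by [].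
split=> [[Y0 YP]|[Y0 YP]].
  split=> [|a x y Yx Yy]; first by apply/set_mem; rewrite -E.
  by apply/set_mem; rewrite -E; apply: YP; rewrite E; exact: mem_set.
split=> [|a x y]; first by rewrite E; exact: mem_set.
rewrite !E => /set_mem Yx /set_mem Yy; apply/mem_set; exact: YP.
Qed.

Lemma closed_finite_codimT : closed_finite_codim [set: X].
Proof.
split; [exact/submod_closed_setP|exact: closedT|].
by exists 0%N, (fun=> 0) => x; exists (fun=> 0).
Qed.

Lemma closed_finite_codim0 Y : closed_finite_codim Y -> Y 0.
Proof. by case=> /submod_closed_setP[]. Qed.

Lemma closed_finite_codimZ Y a x : closed_finite_codim Y -> Y x -> Y (a *: x).
Proof.
case=> /submod_closed_setP[Y0 YP] _ _ Yx.
by rewrite -[a *: x]addr0; exact: YP.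
Qed.

Lemma closed_finite_codimD Y x y : closed_finite_codim Y -> Y x -> Y y -> Y (x + y).
Proof.
case=> /submod_closed_setP[Y0 YP] _ _ Yx Yy.
by rewrite -[x]scale1r; exact: YP.
Qed.

(** Either L vanishes on Y, or some y in Y with L y != 0 together with the old
    spanning vectors spans X modulo the smaller subspace. *)
Lemma closed_finite_codim_ker Y L : closed_finite_codim Y ->
  closed_finite_codim (Y `&` [set x | L x = 0]).
Proof.
move=> cY; have [_ clY [d [e Ye]]] := cY; split.
- apply/submod_closed_setP; split=> [|a x y [Yx /= Lx] [Yy /= Ly]].
    by split; [exact: closed_finite_codim0|exact: linear0].
  split; first by apply: closed_finite_codimD => //; exact: closed_finite_codimZ.
  by rewrite /= (dual_linear L) Lx Ly scaler0 addr0.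
- apply: closedI => //.
  apply: (@preimage_closed _ R L [set x | x = 0]); last exact: closed_eq.
  by move=> x _; exact: dual_continuous.
have [[y Yy Ly]|H] := pselect (exists2 y, Y y & L y != 0); last first.
  exists d, e => x; have [a Ya] := Ye x; exists a; split=> //=.
  by apply/eqP; apply: contrapT => /negP h; apply: H; eexists; eauto.
exists d.+1, (fun i => if unlift ord0 i is Some j then e j else y) => x.
have [a Ya] := Ye x; set w := x - _ in Ya.
pose c := L w / L y.
exists (fun i => if unlift ord0 i is Some j then a j else c).
rewrite big_ord_recl unlift_none.
under eq_bigr do rewrite liftK.
rewrite opprD addrCA -/w addrC; split=> /=.
  by rewrite -scaleNr; apply: closed_finite_codimD => //; exact: closed_finite_codimZ.
by rewrite linearB linearZ/= /c -[_ *: _]/(_ * _) mulfVK// subrr.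
Qed.

Lemma closed_finite_codim_kers Y (L : nat -> dual X) n :
  closed_finite_codim Y -> exists Y',
    [/\ closed_finite_codim Y', Y' `<=` Y &
        forall y i, Y' y -> (i < n)%N -> L i y = 0].
Proof.
move=> cY; elim: n => [|n [Y' [cY' Y'Y LY']]]; first by exists Y; split.
exists (Y' `&` [set x | L n x = 0]); split.
- exact: closed_finite_codim_ker.
- by move=> y [/Y'Y].
- move=> y i [Y'y /= Ly]; rewrite ltnS leq_eqVlt => /predU1P[->|]; first exact: Ly.
  exact: LY'.
Qed.

End FiniteCodimension.

Section Evaluation.
Variables (R : realType) (X : normedModType R).

Lemma evaluation_is_dual (x : X) : is_dual (fun f : dual X => f x : R^o).
Proof.
have linE : linear (fun f : dual X => f x : R^o) by [].
pose E : {linear dual X -> R^o} := HB.pack (fun f : dual X => f x : R^o)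
  (GRing.isLinear.Build _ _ _ _ _ linE).
apply/asboolP; split=> //; apply: (@bounded_linear_continuous _ _ _ E).
apply/linear_boundedP; exists `|x|; split=> [|M xM f]; first exact: normr_real.
by rewrite (le_trans (dual_norm_ub f x))// mulrC ler_wpM2r ?dual_norm_ge0// ltW.
Qed.

Definition evaluation (x : X) : dual (dual X) := Dual (evaluation_is_dual x).

End Evaluation.

(** * Block sequences in the Tsirelson norm *)

Section TsirelsonNorm.
Variable R : realType.
Notation T0 := (tsirelson_c00 R).
Implicit Types (x y : T0).

Lemma tsirelson_norm_tsup : @tsirelson_norm R = @tsup R.
Proof.
apply: tsirelson_norm_unique.
- exact: tsirelson_norm_is_norm.
- exact: tsirelson_normE.
- exact: tsup_is_norm.
- exact: tsup_eq.
Qed.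

Lemma restrC (E F : {fset nat}) (x : c00 R) : restr E (restr F x) = restr F (restr E x).
Proof. by apply/val_inj/funext => i /=; case: ifP; case: ifP. Qed.

(** The norm is the largest subsolution of its implicit equation, and
    composing it with the restriction to E gives another subsolution. *)
Lemma tsirelson_norm_restr E x : `|restr E x : T0| <= `|x|.
Proof.
rewrite !tsirelson_c00_normE tsirelson_norm_tsup.
have [l1 t h _] := @subsol_tsup R.
suff : subsol (fun x => tsup (restr E x)) by exact: tsup_ub.
have l1E : le_l1 (fun x : c00 R => tsup (restr E x)).
  move=> z n zn; rewrite (@le_trans _ _ (\sum_(i < n) `|restr E z i|))//.
    by apply: l1 => i ni /=; rewrite zn// if_same.
  by apply: ler_sum => i _ /=; case: ifP => // _; rewrite normr0.
split=> // [y z|a y|y]; [by rewrite restrD|by rewrite restrZ|].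
rewrite -titer_tsup; apply: titer_le => _ [[i _ <-]|[[k F] /= kF <-]].
  rewrite (le_trans _ (titer_ub_coord y i l1E))//=.
  by case: ifP => // _; rewrite normr0.
rewrite (le_trans _ (titer_ub_sum y l1E kF))// ler_wpM2l//.
by apply: ler_sum => i _; rewrite restrC.
Qed.

Lemma tsirelson_norm_coord x i : `|x i| <= `|x|.
Proof. by apply: tsirelson_eq_coord; exact: tsirelson_normE. Qed.

Lemma admissible_sum_le x k F : admissible k F ->
  \sum_(i < k) `|restr (F i) x : T0| <= 2 * `|x|.
Proof.
move=> kF; rewrite mulrC -ler_pdivrMr// mulrC.
exact: tsirelson_eq_sum (@tsirelson_normE R) kF.
Qed.

Definition supported a b x : Prop := forall i, x i != 0 -> (a <= i < b)%N.

Lemma restr_eq0 E x : (forall i, i \in E -> x i = 0) -> restr E x = 0.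
Proof.
by move=> Ex; apply/val_inj/funext => i /=; case: ifPn => // /Ex.
Qed.

Lemma restr_sum E n (u : nat -> T0) :
  restr E (\sum_(i < n) u i) = \sum_(i < n) restr E (u i) :> T0.
Proof.
elim: n => [|n IH]; first by rewrite !big_ord0; exact: restr_eq0.
by rewrite !big_ord_recr/= restrD IH.
Qed.

(** How an admissible family E_0 < ... < E_(k-1) cuts a block: [mu j] stands for
    the minimum of E_j, and the family is tested on a vector x of norm at most 1
    supported in [a, b).  Members starting at or after b miss x. *)
Section Blocks.
Variables (k : nat) (E : nat -> {fset nat}) (mu : nat -> nat).
Hypotheses (kE : admissible k E)
  (muE : forall j, (j < k)%N -> mu j \in E j)
  (mu_le : forall j a, (j < k)%N -> a \in E j -> (mu j <= a)%N).

(** At most one of the members starting before a meets the support of x: all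
    but the last of these members lie entirely before a. *)
Lemma sum_restr_starting_before a b x : supported a b x -> `|x| <= 1 ->
  \sum_(j < k) (mu j < a)%N%:R * `|restr (E j) x : T0| <= 1.
Proof.
move=> xab x1.
have vanish (j : nat) (c : nat) : (forall i, i \in E j -> (i < a)%N) ->
    restr (E j) x = 0 :> T0.
  move=> h; apply: restr_eq0 => i /h ia; apply/eqP; apply: contraTT ia => /xab.
  by case/andP; rewrite -leqNgt.
have [[j ja jx]|H] := pselect (exists2 j : 'I_k, (mu j < a)%N & restr (E j) x != 0 :> T0).
  rewrite (bigD1 j)//= ja mul1r big1 ?addr0 => [|l lj].
    by rewrite (le_trans (tsirelson_norm_restr _ _)).
  have [la|] := ltnP; last by rewrite mul0r.
  have [lj'|jl|/val_inj lj'] := ltngtP l j; last by rewrite lj' eqxx in lj.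
    rewrite vanish ?normr0 ?mulr0// => i iE.
    by rewrite (ltn_trans _ ja)// (admissible_lt kE lj')// muE.
  exfalso; move/eqP: jx; apply; apply: vanish => // i iE.
  by rewrite (ltn_trans _ la)// (admissible_lt kE jl)// muE.
rewrite big1// => j _; have [ja|] := ltnP; last by rewrite mul0r.
have [->|jx] := eqVneq (restr (E j) x : T0) 0; first by rewrite normr0 mulr0.
by exfalso; apply: H; exists j.
Qed.

(** A block counts for 1, plus 1 for each member of the family that starts
    inside it. *)
Lemma sum_restr_supported a b x : (a <= b)%N -> supported a b x -> `|x| <= 1 ->
  \sum_(j < k) `|restr (E j) x : T0| <=
  1 + \sum_(j < k) ((mu j < b)%N%:R - (mu j < a)%N%:R).
Proof.
move=> ab xab x1.
rewrite (le_trans _ (lerD (sum_restr_starting_before xab x1) (lexx _)))//.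
rewrite -big_split/=; apply: ler_sum => j _.
have [ja|aj] := ltnP (mu j) a.
  by rewrite (leq_trans ja ab) subrr addr0 mul1r.
rewrite mul0r add0r subr0; have [jb|bj] := ltnP (mu j) b.
  by rewrite (le_trans (tsirelson_norm_restr _ _)).
rewrite restr_eq0 ?normr0// => i iE.
apply/eqP; apply: contraTT (mu_le (ltn_ord j) iE) => /xab /andP[_ ib].
by rewrite -ltnNge (leq_trans ib).
Qed.

(** Each of the k members starts inside at most one block, which the telescoping
    sum expresses; the total is thus n + k instead of the trivial 2 n. *)
Lemma sum_restr_blocks (s : nat -> nat) (u : nat -> T0) n :
  (forall i, (s i <= s i.+1)%N) -> (forall i, supported (s i) (s i.+1) (u i)) ->
  (forall i, `|u i| <= 1) ->
  \sum_(j < k) `|restr (E j) (\sum_(i < n) u i) : T0| <= n%:R + k%:R.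
Proof.
move=> s_le su u1.
apply: (@le_trans _ _ (\sum_(j < k) \sum_(i < n) `|restr (E j) (u i) : T0|)).
  by apply: ler_sum => j _; rewrite restr_sum ler_norm_sum.
rewrite exchange_big/=.
apply: (@le_trans _ _ (\sum_(i < n)
    (1 + \sum_(j < k) ((mu j < s i.+1)%N%:R - (mu j < s i)%N%:R)))).
  by apply: ler_sum => i _; exact: sum_restr_supported.
rewrite big_split/= sumr_const card_ord lerD2l exchange_big/=.
apply: (@le_trans _ _ (\sum_(j < k) (1 : R))); last by rewrite sumr_const card_ord.
apply: ler_sum => j _.
rewrite -(big_mkord xpredT (fun i => (mu j < s i.+1)%N%:R - (mu j < s i)%N%:R)).
rewrite telescope_sumr//.
by case: (_ < _)%N; case: (_ < _)%N; rewrite ?subrr ?subr0 ?sub0r// (le_trans (lerN10 _)).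
Qed.

End Blocks.

Lemma admissible_min k E : admissible k E -> exists mu : nat -> nat,
  (forall j, (j < k)%N -> mu j \in E j) /\
  (forall j a, (j < k)%N -> a \in E j -> (mu j <= a)%N).
Proof.
move=> [_ En _ _].
have /choice[mu muP] : forall j, exists m, (j < k)%N ->
    m \in E j /\ forall a, a \in E j -> (m <= a)%N.
  move=> j; have [jk|] := ltnP j k; last by exists 0%N.
  have ex : exists m, m \in E j by have /fset0Pn := En j jk.
  by exists (ex_minn ex); case: ex_minnP.
by exists mu; split=> [j jk|j a jk]; [exact: (muP j jk).1|exact: (muP j jk).2].
Qed.

(** Stated without dividing by n.  A family whose first member starts before
    [s 1] has at most [s 1] members, so its sum on the n later blocks is at
    most n + s 1; any other family does not see the first block. *)
Lemma norm_blocks (s : nat -> nat) (u : nat -> T0) n :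
  (forall i, (s i <= s i.+1)%N) -> (forall i, supported (s i) (s i.+1) (u i)) ->
  (forall i, `|u i| <= 1) ->
  `|n%:R *: u 0%N + \sum_(i < n) u i.+1| <= n%:R + 2^-1 * (n%:R + (s 1%N)%:R).
Proof.
move=> s_le su u1; set y := \sum_(i < n) u i.+1.
have s1 i : (s 1 <= s i.+1)%N by elim: i => // i IH; exact: leq_trans IH (s_le _).
have yn : `|y| <= n%:R.
  rewrite (le_trans (ler_norm_sum _ _ _))// (@le_trans _ _ (\sum_(i < n) (1 : R)))//.
    exact: ler_sum.
  by rewrite sumr_const card_ord.
have y0 i : (i < s 1)%N -> y i = 0.
  move=> is1; rewrite /y; elim: (n) => [|m IH]; first by rewrite big_ord0.
  rewrite big_ord_recr/=.
  rewrite -[LHS]/((\sum_(i < m) u i.+1 : T0) i + u m.+1 i) IH add0r.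
  apply/eqP; apply: contraTT is1 => /su/andP[+ _]; rewrite -leqNgt.
  exact/leq_trans.
have x0 i : (s 1 <= i)%N -> u 0 i = 0.
  by move=> s1i; apply/eqP; apply: contraTT s1i => /su/andP[_]; rewrite -ltnNge.
have bound : n%:R <= n%:R + 2^-1 * (n%:R + (s 1%N)%:R) :> R.
  by rewrite lerDl mulr_ge0// addr_ge0.
rewrite tsirelson_c00_normE.
apply: tsirelson_eq_le (@tsirelson_normE R) _ _ => [i|k E kE].
  rewrite (le_trans _ bound)// -[_ i]/(n%:R * u 0 i + y i).
  have [is1|s1i] := ltnP i (s 1).
    rewrite y0// addr0 normrM normr_nat -[leRHS]mulr1 ler_wpM2l//.
    by rewrite (le_trans (tsirelson_norm_coord _ _)).
  by rewrite x0// mulr0 add0r (le_trans (tsirelson_norm_coord _ _)).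
have [[a aE as1]|H] := pselect (exists2 a, a \in E 0%N & (a < s 1)%N); last first.
  rewrite (le_trans _ bound)// (le_trans _ yn)//.
  rewrite (le_trans _ (tsirelson_eq_sum y (@tsirelson_normE R) kE))// ler_wpM2l//.
  apply: ler_sum => j _; rewrite restrD restrZ [restr _ (u 0)]restr_eq0 ?scaler0 ?add0r//.
  move=> i iE; apply: x0; rewrite leqNgt; apply/negP => is1; apply: H.
  have [k0 En _ _] := kE; have [j0|j0] := posnP (j : nat).
    by exists i => //; rewrite -j0.
  have /fset0Pn[a aE] := En 0%N k0; exists a => //.
  by rewrite (ltn_trans _ is1)// (admissible_lt kE j0 _ aE iE).
have ks1 : (k <= s 1)%N by have [_ _ _ /(_ a aE)] := kE; move/leq_trans; exact.
have [mu [muE mu_le]] := admissible_min kE.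
apply: (@le_trans _ _ (2^-1 * (n%:R * (\sum_(i < k) `|restr (E i) (u 0) : T0|) +
    \sum_(i < k) `|restr (E i) y : T0|))).
  rewrite ler_wpM2l// mulr_sumr -big_split/=; apply: ler_sum => j _.
  rewrite restrD restrZ -tsirelson_c00_normE (le_trans (ler_normD _ _))// lerD2r.
  by rewrite normrZ normr_nat.
rewrite mulrDr lerD//.
  rewrite mulrCA -[leRHS]mulr1 ler_wpM2l// mulrC ler_pdivrMr// mul1r.
  rewrite (le_trans (admissible_sum_le (u 0) kE))//.
  by rewrite -[leRHS]mulr1 ler_wpM2l.
rewrite ler_wpM2l//.
apply: (@le_trans _ _ (n%:R + k%:R)); last by rewrite lerD2l ler_nat.
exact: (sum_restr_blocks kE muE mu_le (s := fun i => s i.+1) (u := fun i => u i.+1)).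
Qed.

End TsirelsonNorm.

(** * The unit vector basis is shrinking *)

Section Shrinking.
Variable R : realType.
Notation T0 := (tsirelson_c00 R).
Implicit Types (x : T0) (g : {linear T0 -> R^o}).

(** The restriction of g to the vectors supported in [M, oo) has norm at
    most C. *)
Definition tail_bounded g M (C : R) : Prop :=
  forall x, (forall i, (i < M)%N -> x i = 0) -> `|g x| <= C * `|x|.

(** A vector x witnessing the failure of the bound is finitely supported;
    multiplied by the sign of g x over the norm of x it is the required
    block. *)
Lemma norming_tail_block g M (C : R) : 0 <= C -> ~ tail_bounded g M C ->
  exists x n, [/\ (M < n)%N, supported M n x, `|x| <= 1 & C <= g x].
Proof.
move=> C0 /existsNP[x /not_implyP[xM /negP]]; rewrite -ltNge => gx.
have x0 : 0 < `|x|.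
  rewrite normr_gt0; apply/eqP => x0; move: gx.
  by rewrite x0 linear0 !normr0 mulr0 ltxx.
have [n xn] := c00_bounded_supp x.
exists ((Num.sg (g x) / `|x|) *: x), (maxn n M.+1); split.
- by rewrite leq_maxr.
- move=> i; rewrite -[_ i]/(Num.sg (g x) / `|x| * x i) => xi.
  have {}xi : x i != 0 by apply: contraNneq xi => ->; rewrite mulr0.
  rewrite leq_max; apply/andP; split.
    by rewrite leqNgt; apply: contraNN xi => /xM ->.
  by rewrite ltnNge; apply/orP; left; apply: contraNN xi => /xn ->.
- rewrite normrZ normrM normfV normr_id mulfVK ?gt_eqF// normr_sg.
  by case: (_ != 0).
- rewrite linearZ/= -[_ *: _]/(Num.sg (g x) / `|x| * g x) mulrAC -normrEsg.
  by rewrite ler_pdivlMr// ltW.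
Qed.

(** Otherwise take successive blocks u_i of norm at most 1 with
    g (u_i) >= 9/10 C, and put m = s 1, the end of the first one.  With n = 2 m,
    the vector w = n u_0 + u_1 + ... + u_n satisfies g w >= 2 n (9/10) C, that
    is 3.6 m C, whereas |w| <= n + (n + m) / 2 = 3.5 m. *)
Lemma tail_bounded_step g M (C : R) : 0 < C -> tail_bounded g M C ->
  exists M', tail_bounded g M' (9 / 10 * C).
Proof.
move=> C0 gM; apply: contrapT => /forallNP H.
have q0 : 0 <= 9 / 10 * C by lra.
have ex m : exists xn : T0 * nat,
    [/\ (m < xn.2)%N, supported m xn.2 xn.1, `|xn.1| <= 1 & 9 / 10 * C <= g xn.1].
  by have [x [n h]] := norming_tail_block q0 (H m); exists (x, n).
have [P HP] := choice ex.
pose s i := iter i (fun m => (P m).2) M; pose u i := (P (s i)).1.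
have slt i : (s i < s i.+1)%N by have [] := HP (s i).
have sle i : (s i <= s i.+1)%N by exact: ltnW.
have su i : supported (s i) (s i.+1) (u i) by have [] := HP (s i).
have u1 i : `|u i| <= 1 by have [] := HP (s i).
have gu i : 9 / 10 * C <= g (u i) by have [] := HP (s i).
have sM i : (M <= s i)%N by elim: i => // i /leq_trans; apply.
pose n := (2 * s 1)%N.
have := norm_blocks n sle su u1; set w := _ + _ => wn.
have uM i j : (j < M)%N -> u i j = 0.
  move=> jM; apply/eqP; apply: contraTT jM => /su/andP[+ _].
  by rewrite -leqNgt; apply/leq_trans.
have wM j : (j < M)%N -> w j = 0.
  move=> jM; rewrite -[LHS]/(n%:R * u 0 j + (\sum_(i < n) u i.+1 : T0) j).
  rewrite uM// mulr0 add0r; elim: (n) => [|m IH]; first by rewrite big_ord0.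
  rewrite big_ord_recr/=.
  by rewrite -[LHS]/((\sum_(i < m) u i.+1 : T0) j + u m.+1 j) IH add0r uM.
have gw_ge : 2 * n%:R * (9 / 10 * C) <= g w.
  rewrite linearD linearZ linear_sum /=.
  have -> : 2 * n%:R * (9 / 10 * C) = n%:R * (9 / 10 * C) + \sum_(i < n) (9 / 10 * C).
    by rewrite sumr_const card_ord -mulr_natl; lra.
  by rewrite lerD//; [rewrite -[_ *: _]/(n%:R * g (u 0%N)) ler_wpM2l|exact: ler_sum].
have := le_trans (ler_norm (g w)) (gM w wM).
have := ler_wpM2l (ltW C0) wn.
have nE : n%:R = 2 * (s 1%N)%:R :> R by rewrite natrM.
have : 0 < C * (s 1%N)%:R.
  by rewrite mulr_gt0// ltr0n (leq_ltn_trans _ (slt 0%N)).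
move: gw_ge; rewrite nE; set m := (s 1%N)%:R.
by nra.
Qed.

Lemma tail_bounded_geometric g (C : R) n : 0 < C -> tail_bounded g 0 C ->
  exists M, tail_bounded g M ((9 / 10) ^+ n * C).
Proof.
move=> C0 gC; elim: n => [|n [M gM]]; first by exists 0%N; rewrite expr0 mul1r.
have [|M' gM'] := tail_bounded_step _ gM; first by rewrite mulr_gt0// exprn_gt0//; lra.
by exists M'; rewrite exprS -mulrA.
Qed.

Lemma tail_bounded_small g (C : R) (e : R) : 0 < C -> tail_bounded g 0 C -> 0 < e ->
  exists M, tail_bounded g M e.
Proof.
move=> C0 gC e0.
have q1 : `|9 / 10 : R| < 1 by rewrite ger0_norm; lra.
have /cvgrPdist_lt/(_ _ (divr_gt0 e0 C0))[n _ /(_ n (leqnn n))/=] := cvg_expr q1.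
rewrite sub0r normrN ltr_pdivlMr// => qn.
have [M gM] := tail_bounded_geometric n C0 gC; exists M => x xM.
rewrite (le_trans (gM x xM))// ler_wpM2r// ltW// (le_lt_trans _ qn)//.
by rewrite ler_wpM2r ?ler_norm// ltW.
Qed.

Lemma tail_bounded_leq g M M' e : (M <= M')%N ->
  tail_bounded g M e -> tail_bounded g M' e.
Proof. by move=> MM gM x xM'; apply: gM => i iM; rewrite xM'// (leq_trans iM). Qed.

End Shrinking.

(** * Blocks in the dual *)

Section TsirelsonDual.
Variable R : realType.
Notation T0 := (tsirelson_c00 R).
Notation T := (tsirelson_space R).
Implicit Types (x : T0) (f : dual T).

Notation inj := (@completion_inj R T0).

Definition on_c00 f : {linear T0 -> R^o} := (f : {linear T -> R^o}) \o inj.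

Lemma dual_tail_bounded f (e : R) : 0 < e -> exists M, tail_bounded (on_c00 f) M e.
Proof.
move=> e0; apply: (@tail_bounded_small _ _ (dual_norm f + 1)) => //.
  by rewrite ltr_wpDl// dual_norm_ge0.
move=> x _; rewrite (le_trans (dual_norm_ub f _))// completion_inj_norm.
by rewrite ler_wpM2r// lerDl.
Qed.

(** The finitely supported vectors are dense in the completion. *)
Lemma dual_norm_le_c00 f (C : R) : 0 <= C -> (forall x, `|on_c00 f x| <= C * `|x|) ->
  `|f| <= C.
Proof.
move=> C0 fC; apply: dual_norm_le => // x.
apply/ler_addgt0Pl => e e0.
have D0 : 0 < dual_norm f + C + 1.
  by rewrite ltr_wpDl// addr_ge0// dual_norm_ge0.
have [v xv] := completion_inj_dense x (divr_gt0 e0 D0).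
rewrite -[x](subrK (inj v)) linearD (le_trans (ler_normD _ _))//.
have h1 := le_trans (dual_norm_ub f (x - inj v)) (ler_wpM2l (dual_norm_ge0 f) xv).
have h2 := fC v.
have h3 : `|v| <= `|x| + e / (dual_norm f + C + 1).
  rewrite -(completion_inj_norm v) -lerBlDl (le_trans _ xv)//.
  by rewrite (le_trans (lerB_dist _ _))// distrC.
have h4 := ler_wpM2l C0 h3.
rewrite subrK.
have E : e = (dual_norm f + C + 1) * (e / (dual_norm f + C + 1)).
  by rewrite mulrC divfK// gt_eqF.
have : 0 < e / (dual_norm f + C + 1) by rewrite divr_gt0.
move: h1 h2 h3 h4 E; rewrite /on_c00/=; set d := e / _; nra.
Qed.

End TsirelsonDual.

Section Intervals.
Variable R : realType.
Notation T0 := (tsirelson_c00 R).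
Implicit Types x : T0.

Definition segment (a b : nat) : {fset nat} := [fset i in iota a (b - a)]%fset.

Lemma in_segment a b i : (i \in segment a b) = (a <= i < b)%N.
Proof. by rewrite !inE mem_iota; lia. Qed.

(** The last piece is the restriction to a finite set, so that
    [tsirelson_norm_restr] applies to tails as well. *)
Lemma restr_segment_split x a b : (a <= b)%N -> exists2 E : {fset nat},
  forall i, i \in E -> (b <= i)%N &
  x = restr (segment 0 a) x + (restr (segment a b) x + restr E x).
Proof.
move=> ab; have [n xn] := c00_bounded_supp x.
exists (segment b n) => [i|]; first by rewrite in_segment => /andP[].
apply/val_inj/funext => i.
rewrite /= !fctE /= !in_segment.
have [ni|ni] := leqP n i; first by rewrite xn// !if_same !addr0.
have [ia|ai] /= := ltnP i a.
  by rewrite [(b <= i)%N]leqNgt (leq_trans ia ab)/= !addr0.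
by have [ib|bi] := ltnP i b; rewrite /= add0r ?addr0// add0r.
Qed.

Lemma unit_vector_is_c00 i : is_c00 (fun j => (j == i)%:R : R^o).
Proof.
apply/asboolP; apply: (@sub_finite_set _ _ [set i]); last exact: finite_set1.
by move=> j; apply: contra_neqP => /eqP/negbTE ->.
Qed.

Definition unit_vector i : T0 := C00 (unit_vector_is_c00 i).

Lemma restr_head0 (g : {linear T0 -> R^o}) x n :
  (forall i, (i < n)%N -> g (unit_vector i) = 0) -> g (restr (segment 0 n) x) = 0.
Proof.
elim: n => [|n IH] g0.
  by rewrite restr_eq0 ?linear0// => i; rewrite in_segment.
have -> : restr (segment 0 n.+1) x =
    restr (segment 0 n) x + x n *: unit_vector n :> T0.
  apply/val_inj/funext => i; rewrite /= !fctE /= !in_segment/= ltnS.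
  rewrite -[_ *: _]/(x n * (i == n)%:R).
  by case: ltngtP => [||->]; rewrite /= ?mulr0 ?mulr1 ?addr0 ?add0r.
by rewrite linearD linearZ/= g0// scaler0 addr0 IH// => i /ltnW; exact: g0.
Qed.

End Intervals.

(** * Escaping from a cover of the dual ball *)

Section Covering.
Variable R : realType.
Notation T0 := (tsirelson_c00 R).
Notation T := (tsirelson_space R).
Implicit Types (x : T0) (f z : dual T).

(** What remains of z being the sum of t vectors of norm at most r, the i-th of
    which lives on the segment [N i, N i.+1) of coordinates up to an error e in
    norm. *)
Definition block_bounded (r e : R) t (N : nat -> nat) z : Prop := forall x,
  `|on_c00 z x| <=
    r * (\sum_(i < t) `|restr (segment (N i) (N i.+1)) x : T0|) + t%:R * e * `|x|.

(** The segments form an admissible family since t <= N 0 + 1, the coordinate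
    of index N 0 being the positive integer N 0 + 1. *)
Lemma block_bounded_norm (r e : R) t N z : 0 <= r -> 0 <= e ->
  (forall i, (i < t)%N -> (N i < N i.+1)%N) -> (t <= (N 0%N).+1)%N ->
  block_bounded r e t N z -> `|z| <= 2 * r + t%:R * e.
Proof.
move=> r0 e0 N_lt tN zN; apply: dual_norm_le_c00 => [|x].
  by rewrite addr_ge0 ?mulr_ge0.
rewrite (le_trans (zN x))// mulrDl lerD2r [2 * r]mulrC -mulrA ler_wpM2l//.
have [->|t0] := posnP t; first by rewrite big_ord0 mulr_ge0.
apply: (@admissible_sum_le _ x t (fun i => segment (N i) (N i.+1))); split=> //.
- by move=> i it; apply/fset0Pn; exists (N i); rewrite in_segment leqnn N_lt.
- move=> i a b it; rewrite !in_segment => /andP[_ aN] /andP[Nb _].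
  exact: leq_trans Nb.
- by move=> a; rewrite in_segment => /andP[Na _]; rewrite (leq_trans tN).
Qed.

(** The increment y vanishes before N t, and its tail after some M has norm at
    most e because the basis is shrinking. *)
Lemma block_bounded_add (r e : R) t N z y : 0 <= r -> 0 < e ->
  block_bounded r e t N z -> `|y| <= r ->
  (forall i, (i < N t)%N -> on_c00 y (unit_vector R i) = 0) ->
  exists2 M, (N t < M)%N &
    block_bounded r e t.+1 (fun i => if (i <= t)%N then N i else M) (z + y).
Proof.
move=> r0 e0 zN yr yN; have [M0 yM0] := dual_tail_bounded y e0.
pose M := maxn M0 (N t).+1.
have NM : (N t < M)%N by rewrite leq_maxr.
have yM := tail_bounded_leq (leq_maxl M0 (N t).+1 : (M0 <= M)%N) yM0.
exists M => // x; rewrite -[on_c00 (z + y) x]/(on_c00 z x + on_c00 y x).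
rewrite big_ord_recr/= leqnn ltnn.
rewrite (eq_bigr (fun i : 'I_t => `|restr (segment (N i) (N i.+1)) x : T0|)); last first.
  by move=> i _; rewrite (ltnW (ltn_ord i)) ltn_ord.
have [E EM xE] := restr_segment_split x (ltnW NM).
have yx : `|on_c00 y x| <= r * `|restr (segment (N t) M) x : T0| + e * `|x|.
  rewrite {1}xE linearD (restr_head0 _ yN) add0r linearD.
  rewrite (le_trans (ler_normD _ _))// lerD//.
    rewrite (le_trans (dual_norm_ub y _))// completion_inj_norm.
    by rewrite ler_wpM2r.
  rewrite (le_trans (yM _ _))//.
    move=> i iM /=; case: ifPn => // /EM Mi.
    by rewrite leqNgt iM in Mi.
  by rewrite ler_wpM2l ?tsirelson_norm_restr// ltW.
rewrite (le_trans (ler_normD _ _))// (le_trans (lerD (zN x) yx))//.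
by rewrite -[t.+1]addn1 natrD; lra.
Qed.

(** The walk of the proof, for a cover none of whose members contains a ball of
    radius r, centred in it, of a closed subspace of finite codimension. *)
Section Greedy.
Variables (n : nat) (A : 'I_n -> set (dual T)) (r e : R).
Hypotheses (r0 : 0 < r) (e0 : 0 < e) (re : 2 * r + n%:R * e <= 1).
Hypotheses (clA : forall k, closed (A k)) (cA : forall k, convex_set (A k)).
Hypothesis (coverA : forall f, `|f| <= 1 -> exists k, A k f).
Hypothesis (escape : forall k z Y, A k z -> closed_finite_codim Y ->
  exists y, [/\ Y y, `|y| <= 1 & ~ A k (z + r *: y)]).

(** S collects the members of the cover that the walk has left, and W the
    directions in which it may continue without returning to them.  As N 0 = n,
    the segments of up to n increments form an admissible family. *)
Lemma greedy_escape t : (t <= n)%N -> exists z N (S : {set 'I_n}) W,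
  [/\ block_bounded r e t N z,
      (forall i, (i < t)%N -> (N i < N i.+1)%N) /\ N 0%N = n,
      #|S| = t,
      closed_finite_codim W &
      forall k w, k \in S -> W w -> ~ A k (z + w)].
Proof.
elim: t => [_|t IH tn].
  exists 0, (fun=> n), finset.set0, setT; split=> //.
  - by move=> x; rewrite -[on_c00 _ _]/(0 : R) normr0 big_ord0 mulr0 !mul0r addr0.
  - by rewrite cards0.
  - exact: closed_finite_codimT.
  - by move=> k w; rewrite inE.
have [z [N [S [W [zN [N_lt N0] St cW SW]]]]] := IH (ltnW tn).
have z1 : `|z| <= 1.
  rewrite (le_trans (block_bounded_norm (ltW r0) (ltW e0) N_lt _ zN))//.
    by rewrite N0 ltnW// ltnS ltnW.
  rewrite (le_trans _ re)// lerD2l ler_wpM2r ?ler_nat; [by []|exact: ltW|exact: ltnW].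
have [k Akz] := coverA z1.
have kS : k \notin S.
  apply/negP => kS; apply: (SW k 0 kS (closed_finite_codim0 cW)).
  by rewrite addr0.
(* Increments in Y keep away from the sets already left and vanish on the
   coordinates used so far. *)
have [Y [cY YW Y0]] := closed_finite_codim_kers
  (fun i => evaluation (completion_inj (unit_vector R i))) (N t) cW.
have [y [Yy y1 yA]] := escape Akz cY.
have [L LA] := separating_functional (@clA k) (@cA k) yA.
have yr : `|r *: y| <= r.
  by rewrite normrZ gtr0_norm// -[leRHS]mulr1 ler_wpM2l// ltW.
have yN i : (i < N t)%N -> on_c00 (r *: y) (unit_vector R i) = 0.
  move=> iN; rewrite -[LHS]/(r * y (completion_inj (unit_vector R i))).
  by have := Y0 y i Yy iN; rewrite /= => ->; rewrite mulr0.
have [M NM zyM] := block_bounded_add (ltW r0) e0 zN yr yN.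
exists (z + r *: y), (fun i => if (i <= t)%N then N i else M), (k |: S)%SET,
  (W `&` [set w | L w = 0]).
split=> //.
- split=> // i /[1!ltnS] it; rewrite it; move: it.
  rewrite leq_eqVlt => /predU1P[->|it]; first by rewrite ltnn.
  by rewrite it N_lt.
- by rewrite cardsU1 kS St.
- exact: closed_finite_codim_ker.
move=> j w; rewrite !inE => /predU1P[->|jS] [Ww /= Lw] Aj.
  have LD : L (z + r *: y + w) = L (z + r *: y) + L w by rewrite linearD.
  by have := LA _ Aj; rewrite LD Lw addr0 eqxx.
apply: (SW j (r *: y + w) jS); last by rewrite addrA.
by apply: closed_finite_codimD => //; apply: closed_finite_codimZ => //; exact: YW.
Qed.

(** A walk of n steps has left all n sets, yet still ends in the unit ball. *)
Lemma greedy_escape_contradiction : False.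
Proof.
have [z [N [S [W [zN [N_lt N0] Sn cW SW]]]]] := greedy_escape (leqnn n).
have z1 : `|z| <= 1.
  rewrite (le_trans (block_bounded_norm (ltW r0) (ltW e0) N_lt _ zN))//.
  by rewrite N0.
have [k Akz] := coverA z1.
have kS : k \in S.
  suff -> : S = [set: 'I_n]%SET by rewrite inE.
  by apply/eqP; rewrite eqEcard finset.subsetT cardsT card_ord Sn /=.
apply: (SW k 0 kS (closed_finite_codim0 cW)).
by rewrite addr0.
Qed.

End Greedy.

End Covering.

Lemma covering_index_ge (R : realType) (n : nat) :
  ((2^-1)%:E <= covering_index (dual (tsirelson_space R)) n)%E.
Proof.
apply: le_ereal_inf_tmp => _ [A [Abcc AB] <-].
rewrite leNgt; apply/negP; set c := \big[_/_]_(k < n) _ => c_half.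
have c_ge k : (ess_inradius (A k) <= c)%E by exact: le_bigmax_cond.
have c0 : (0 <= c)%E by exact: bigmax_ge_id.
have cE : c = (fine c)%:E.
  by rewrite fineK// ge0_fin_numE// (lt_trans c_half)// ltry.
have c0' : 0 <= fine c by rewrite -lee_fin -cE.
have c_half' : fine c < 2^-1 by rewrite -lte_fin -cE.
have c_ge' k : (ess_inradius (A k) <= (fine c)%:E)%E by rewrite -cE.
(* r lies strictly between the largest inradius and 1/2, and e absorbs the
   errors of the tails: 2 r + n e <= 1. *)
pose r := (fine c + 2^-1) / 2.
have r0 : 0 < r by rewrite /r; lra.
have rc : fine c < r by rewrite /r; lra.
have r_half : 2 * r < 1 by rewrite /r; lra.
have n1 : 0 < n.+1%:R :> R by rewrite ltr0n.
pose e := (1 - 2 * r) / n.+1%:R.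
have e0 : 0 < e by rewrite divr_gt0// subr_gt0.
apply: (@greedy_escape_contradiction R n A r e r0 e0).
- have n1e : 2 * r + n.+1%:R * e = 1 by rewrite [n.+1%:R * e]mulrC divfK ?gt_eqF//; lra.
  by rewrite -[leRHS]n1e lerD2l ler_wpM2r ?(ltW e0)// ler_nat.
- by move=> k; have [] := Abcc k.
- by move=> k; have [] := Abcc k.
- move=> f f1; have [k _ Akf] : (\bigcup_k A k) f by rewrite AB.
  by exists k.
move=> k z Y Akz cY; apply: contrapT => H.
have : (r%:E <= (fine c)%:E)%E.
  apply: le_trans (c_ge' k); rewrite le_max; apply/orP; right.
  apply: ereal_sup_ubound; exists r => //; split=> //; exists z => //; exists Y => //.
  move=> _ [y [y1 Yy] <-]; apply: contrapT => nA; apply: H; exists y; split=> //.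
by rewrite lee_fin leNgt rc.
Qed.

Theorem corollary4p5 (R : realType) :
  ((2^-1)%:E <= limn (covering_index (dual (tsirelson_space R))))%E.
Proof.
apply: lime_ge; first exact: covering_index_is_cvg.
by apply: nearW => n; exact: covering_index_ge.
Qed.
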